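(* Let $X$ be a Banach space. Then $X$ is WLD and $(B_{X^*},w^* )$ has property (M) if and only if the injective tensor product $X\widehat{\otimes}_\varepsilon X$ is WLD.
   Context: All Banach spaces are real; an operator is a continuous linear map. $(B_{X^*},w^* )$ is the closed unit ball of $X^*$ with the weak$^*$ topology. For a non-empty set $\Gamma$, $\ell_\infty^c(\Gamma)$ is the subspace of $\ell_\infty(\Gamma)$ consisting of all bounded functions $f:\Gamma\to\mathbb{R}$ with countable support, and $\tau_p(\Gamma)$ is the topology of pointwise convergence on $\Gamma$. A Banach space $X$ is weakly Lindelöf determined (WLD) if there exist a non-empty set $\Gamma$ and an injective operator $\Phi:X^*\to\ell_\infty^c(\Gamma)$ which is $w^*$-to-$\tau_p(\Gamma)$ continuous. Equivalently, $(B_{X^*},w^* )$ is a Corson compact space, i.e. it embeds homeomorphically into $[-1,1]^\Gamma\cap\ell_\infty^c(\Gamma)$ with $\tau_p(\Gamma)$ for some $\Gamma$. A Corson compact space $K$ has property (M) if every regular Borel probability measure on $K$ has separable support. *)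

(* Defs.v *)
From HB Require Import structures.
From mathcomp Require Import all_boot all_order all_algebra.
From mathcomp Require Import all_classical all_reals all_analysis.

Set Implicit Arguments.
Unset Strict Implicit.
Unset Printing Implicit Defensive.
Import Order.TTheory GRing.Theory Num.Theory.
Import numFieldNormedType.Exports.
Local Open Scope classical_set_scope.
Local Open Scope ring_scope.

(* The Banach space of all bounded functions T -> R with the supremum norm
   (with sup set0 = 0 this is the zero space when T is empty). *)
Section linf.
Context {R : realType} (T : Type).

Definition linf_set : set (T -> R) := bounded_fun.

Lemma linf_setP (f : T -> R) :
  linf_set f <-> exists M, forall x, `|f x| <= M.
Proof.
split=> [[M [_ Mf]]|[M Mf]].
  by exists (M + 1) => x; apply: (Mf (M + 1)) => //; rewrite ltrDl.
exists M; split; first exact: num_real.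
by move=> N MN x _ /=; apply: le_trans (Mf x) (ltW MN).
Qed.

Definition linf_pred : {pred T -> R} := mem linf_set.

Fact linf_submod_closed : submod_closed linf_pred.
Proof.
split=> [|a f g]; rewrite !inE /=.
  by apply/linf_setP; exists 0 => x; rewrite normr0.
move=> /linf_setP[M Mf] /linf_setP[N Ng]; apply/linf_setP.
exists (`|a| * M + N) => x.
rewrite (le_trans (ler_normD _ _))// lerD// normrM.
by rewrite ler_wpM2l.
Qed.

HB.instance Definition _ :=
  GRing.isSubmodClosed.Build R (T -> R) linf_pred linf_submod_closed.

Record linf : Type := Linf {
  linf_fun :> T -> R;
  linf_funP : linf_fun \in linf_pred }.

HB.instance Definition _ := [isSub for linf_fun].
HB.instance Definition _ := [Choice of linf by <:].
HB.instance Definition _ := [SubChoice_isSubLmodule of linf by <:].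

Lemma linfE (f g : linf) : f =1 g -> f = g.
Proof. by move=> fg; apply/val_inj/funext. Qed.

Definition linf_norm (f : linf) : R := sup [set `|f x| | x in [set: T]].

Lemma linf_le_norm (f : linf) x : `|f x| <= linf_norm f.
Proof.
apply: ub_le_sup; last by exists x.
have := linf_funP f; rewrite inE => /linf_setP[M Mf].
by exists M => _ [y _ <-].
Qed.

Lemma linf_norm_le (f : linf) M :
  0 <= M -> (forall x, `|f x| <= M) -> linf_norm f <= M.
Proof.
move=> M0 Mf; rewrite /linf_norm.
have [[x]|nT] := pselect (exists x : T, True).
  by move=> _; apply: ge_sup => [|_ [y _ <-]//]; exists `|f x|, x.
rewrite (_ : [set _ | _ in _] = set0) ?sup0//.
by rewrite -subset0 => y [x _ _]; apply: nT; exists x.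
Qed.

Lemma linf_norm_ge0 (f : linf) : 0 <= linf_norm f.
Proof.
have [[x]|nT] := pselect (exists x : T, True).
  by move=> _; exact: le_trans (normr_ge0 _) (linf_le_norm f x).
rewrite /linf_norm (_ : [set _ | _ in _] = set0) ?sup0//.
by rewrite -subset0 => y [x _ _]; apply: nT; exists x.
Qed.

Fact linf_normD f g : linf_norm (f + g) <= linf_norm f + linf_norm g.
Proof.
apply: linf_norm_le => [|x]; first by rewrite addr_ge0 ?linf_norm_ge0.
by rewrite (le_trans (ler_normD _ _))// lerD// linf_le_norm.
Qed.

Fact linf_normZ (a : R) f : linf_norm (a *: f) = `|a| * linf_norm f.
Proof.
have le b h : linf_norm (b *: h) <= `|b| * linf_norm h.
  apply: linf_norm_le => [|x]; first by rewrite mulr_ge0 ?linf_norm_ge0.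
  by rewrite normrM ler_wpM2l// linf_le_norm.
apply/eqP; rewrite eq_le le/=.
have [->|a0] := eqVneq a 0; first by rewrite normr0 mul0r linf_norm_ge0.
have := le a^-1 (a *: f); rewrite scalerA mulVf// scale1r.
by rewrite normfV ler_pdivlMl ?normr_gt0.
Qed.

Fact linf_norm0_eq0 f : linf_norm f = 0 -> f = 0.
Proof.
move=> f0; apply: linfE => x; apply/eqP.
by rewrite -normr_le0 -f0 linf_le_norm.
Qed.

HB.instance Definition _ := @Lmodule_isNormed.Build R linf
  linf_norm linf_normD linf_normZ linf_norm0_eq0.

Lemma linf_normE (f : linf) : `|f| = sup [set `|f x| | x in [set: T]].
Proof. by []. Qed.

Fact linf_complete (F : set_system linf) :
  ProperFilter F -> cauchy F -> cvg F.
Proof.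
move=> FF /cauchy_ballP Fc.
have Fc' (e : R) : 0 < e -> exists2 A, F A &
    forall f g, A f -> A g -> forall x, `|f x - g x| <= e.
  move=> e0; have /(_ _ e0) := Fc.
  case=> -[A B] /= [FA FB] AB; exists (A `&` B); first exact: filterI.
  move=> f g [Af _] [_ Bg] x.
  have /= := AB (f, g) (conj Af Bg); rewrite -ball_normE /= => /ltW.
  exact: le_trans (linf_le_norm (f - g) x).
have cx x : cvg ((fun f : linf => f x) @ F).
  apply: cauchy_cvg; apply/cauchy_ballP => e e0.
  have [A FA AP] := Fc' (e / 2) (divr_gt0 e0 (ltr0Sn _ 1)).
  exists ((fun f : linf => f x) @` A, (fun f : linf => f x) @` A) => /=.
    by split; apply: (@filterS _ F _ A) => // f Af; exists f.
  move=> [_ _] [/= [f Af <-] [g Ag <-]]; rewrite -ball_normE /=.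
  rewrite (le_lt_trans (AP _ _ Af Ag x))//.
  by rewrite ltr_pdivrMr// ltr_pMr// ltr1n.
pose l x := lim ((fun f : linf => f x) @ F).
have lP (e : R) : 0 < e -> exists2 A, F A &
    forall f, A f -> forall x, `|l x - f x| <= e.
  move=> e0; have [A FA AP] := Fc' e e0; exists A => // f Af x.
  apply: (@closed_cvg _ _ F _ (fun g : linf => g x)
    (fun r => `|r - f x| <= e)).
  - rewrite (_ : (fun r => _) = closed_ball_ Num.norm (f x) e).
      exact: closed_closed_ball_.
    by apply/funext => r; rewrite /closed_ball_ /= distrC.
  - by apply: filterS FA => g Ag; exact: AP.
  - exact: cx.
have lb : l \in linf_pred.
  rewrite inE; apply/linf_setP.
  have [A FA AP] := lP 1 ltr01; have [f Af] := filter_ex FA.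
  exists (1 + linf_norm f) => x; rewrite -(subrK (f x) (l x)).
  by rewrite (le_trans (ler_normD _ _))// lerD// ?AP// linf_le_norm.
apply/cvg_ex; exists (Linf lb); apply/cvgrPdist_le => e e0.
have [A FA AP] := lP e e0; apply: filterS FA => f Af.
by apply: linf_norm_le => [|x]; [exact: ltW|exact: AP].
Qed.

HB.instance Definition _ := Uniform_isComplete.Build linf linf_complete.

End linf.
Arguments linf R T : clear implicits.

(* [dual X] carries the norm topology; the weak-star topology lives on the
   alias [weakstar X], and on the closed unit ball [dual_ball X]. *)
Section dual.
Context {R : realType} (X : normedModType R).

Definition dual_pred : {pred X -> R} :=
  mem [set f : X -> R | linear f /\ continuous f].

Fact dual_submod_closed : submod_closed dual_pred.
Proof.
split=> [|a f g]; rewrite !inE /=.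
  by split=> [b x y|x]; [rewrite /= scaler0 addr0|exact: cst_continuous].
move=> [lf cf] [lg cg]; split=> [b x y|x].
  rewrite !fctE lf lg !scalerDr !scalerA (mulrC a b) -!addrA; congr (_ + _).
  by rewrite addrCA.
by apply: cvgD; [apply: cvgZr; exact: cf|exact: cg].
Qed.

HB.instance Definition _ :=
  GRing.isSubmodClosed.Build R (X -> R) dual_pred dual_submod_closed.

Record dual : Type := Dual {
  dual_fun :> X -> R;
  dual_funP : dual_fun \in dual_pred }.

HB.instance Definition _ := [isSub for dual_fun].
HB.instance Definition _ := [Choice of dual by <:].
HB.instance Definition _ := [SubChoice_isSubLmodule of dual by <:].

Lemma dual_linear (f : dual) : linear f.
Proof. by have := dual_funP f; rewrite inE => -[]. Qed.

Lemma dual_continuous (f : dual) : continuous f.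
Proof. by have := dual_funP f; rewrite inE => -[]. Qed.

HB.instance Definition _ (f : dual) :=
  GRing.isLinear.Build R X R *:%R f (dual_linear f).

Lemma dualE (f g : dual) : f =1 g -> f = g.
Proof. by move=> fg; apply/val_inj/funext. Qed.

Definition dual_norm (f : dual) : R := sup [set `|f x| | x in [set x | `|x| <= 1]].

Lemma dual_has_sup (f : dual) : has_sup [set `|f x| | x in [set x | `|x| <= 1]].
Proof.
split; first by exists `|f 0|, 0 => //=; rewrite normr0.
have /linear_bounded_continuous/bounded_funP/(_ 1)[M fM] := @dual_continuous f.
by exists M => _ [x /= x1 <-]; exact: fM.
Qed.

Lemma dual_norm_ge0 (f : dual) : 0 <= dual_norm f.
Proof.
apply: ub_le_sup; first by case: (dual_has_sup f).
by exists 0; rewrite /= ?linear0 normr0.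
Qed.

Lemma dual_le_norm (f : dual) x : `|f x| <= dual_norm f * `|x|.
Proof.
have [->|x0] := eqVneq x 0; first by rewrite linear0 !normr0 mulr0.
have nx0 : 0 < `|x| by rewrite normr_gt0.
rewrite -ler_pdivrMr// mulrC -[X in X * _]gtr0_norm ?invr_gt0//.
rewrite -normrM -[_ * f x]/(_ *: f x) -linearZ.
apply: ub_le_sup; first by case: (dual_has_sup f).
exists (`|x|^-1 *: x) => //=.
by rewrite normrZ normfV normr_id mulVf// gt_eqF.
Qed.

Lemma dual_norm_le (f : dual) M :
  (forall x, `|x| <= 1 -> `|f x| <= M) -> dual_norm f <= M.
Proof.
move=> fM; apply: ge_sup; first by case: (dual_has_sup f).
by move=> _ [x /= x1 <-]; exact: fM.
Qed.

Lemma dual_le_norm1 (f : dual) x : `|x| <= 1 -> `|f x| <= dual_norm f.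
Proof.
move=> x1; rewrite (le_trans (dual_le_norm f x))//.
by rewrite ler_piMr// dual_norm_ge0.
Qed.

Fact dual_normD f g : dual_norm (f + g) <= dual_norm f + dual_norm g.
Proof.
apply: dual_norm_le => x x1.
by rewrite (le_trans (ler_normD _ _))// lerD// dual_le_norm1.
Qed.

Fact dual_normZ (a : R) f : dual_norm (a *: f) = `|a| * dual_norm f.
Proof.
have le b h : dual_norm (b *: h) <= `|b| * dual_norm h.
  by apply: dual_norm_le => x x1; rewrite normrM ler_wpM2l// dual_le_norm1.
apply/eqP; rewrite eq_le le/=.
have [->|a0] := eqVneq a 0; first by rewrite normr0 mul0r dual_norm_ge0.
have := le a^-1 (a *: f); rewrite scalerA mulVf// scale1r.
by rewrite normfV ler_pdivlMl ?normr_gt0.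
Qed.

Fact dual_norm0_eq0 f : dual_norm f = 0 -> f = 0.
Proof.
move=> f0; apply: dualE => x; apply/eqP.
by rewrite -normr_le0 (le_trans (dual_le_norm f x))// f0 mul0r.
Qed.

HB.instance Definition _ := @Lmodule_isNormed.Build R dual
  dual_norm dual_normD dual_normZ dual_norm0_eq0.

Lemma dual_normE (f : dual) :
  `|f| = sup [set `|f x| | x in [set x | `|x| <= 1]].
Proof. by []. Qed.

Definition weakstar := initial_topology (fun f : dual => f : {ptws X -> R}).

HB.instance Definition _ := Topological.on weakstar.

Definition dual_ball := {f : dual | `|f| <= 1}.

HB.instance Definition _ := Choice.on dual_ball.

Fact dual_ball0_subproof : `|0 : dual| <= 1.
Proof. by rewrite normr0. Qed.

HB.instance Definition _ :=
  isPointed.Build dual_ball (exist _ 0 dual_ball0_subproof).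

Definition dual_ball_fun (f : dual_ball) : dual := val f.

HB.instance Definition _ := Topological.copy dual_ball
  (initial_topology (dual_ball_fun : dual_ball -> weakstar)).

End dual.

Lemma ptws_continuousP {R : realType} (T : topologicalType) (I : Type)
    (f : T -> {ptws I -> R}) :
  continuous f <-> forall i, continuous (fun t => f t i).
Proof.
split=> [cf i t|cf t].
  have /cvg_sup/(_ i) ci := cf t.
  pose W := initial_topology (fun g : I -> R => g i).
  have ic : (fun g : W => g i) @ (f t : W) --> f t i.
    exact: initial_continuous.
  exact: (cvg_comp (f : T -> W) (fun g : W => g i) ci ic).
apply/cvg_sup => i.
exact: (@continuous_comp_initial _ _ _ (fun f : I -> R => f i) f (cf i)).
Qed.

Lemma weakstar_continuousP {R : realType} (X : normedModType R)
    (T : topologicalType) (f : T -> weakstar X) :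
  continuous f <-> forall x, continuous (fun t => (f t : dual X) x).
Proof.
rewrite -(ptws_continuousP (fun t => (f t : dual X) : X -> R)).
split=> [cf t|cf]; last exact: continuous_comp_initial.
apply: (@continuous_comp _ _ _ f
  (fun g : weakstar X => (g : dual X) : {ptws X -> R})); first exact: cf.
exact: initial_continuous.
Qed.

Lemma dual_ball_continuousP {R : realType} (X : normedModType R)
    (T : topologicalType) (f : T -> dual_ball X) :
  continuous f <-> forall x, continuous (fun t => dual_ball_fun (f t) x).
Proof.
rewrite -(weakstar_continuousP (fun t => dual_ball_fun (f t) : weakstar X)).
split=> [cf t|cf]; last exact: continuous_comp_initial.
apply: (@continuous_comp _ _ _ f
  (fun g : dual_ball X => dual_ball_fun g : weakstar X)); first exact: cf.
exact: initial_continuous.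
Qed.

(* The injective norm of u = \sum_i x_i (x) y_i is the supremum of
   `|\sum_i f x_i * g y_i| over f, g in the dual unit balls. Evaluating u at
   such pairs (f, g) therefore embeds the algebraic tensor product of X and Y,
   with the injective norm, isometrically into the Banach space of bounded
   functions on the product of the dual balls (the embedding is one-to-one by
   the Hahn-Banach theorem). [alg_tensor] is the image of this embedding and
   [itensor X Y] the completion of the algebraic tensor product, obtained as
   the closure of that image. *)
Section injective_tensor_product.
Context {R : realType} (X Y : normedModType R).

Let ambient := linf R (dual_ball X * dual_ball Y)%type.

Fact tensor_subproof (x : X) (y : Y) :
  (fun p : dual_ball X * dual_ball Y =>
    dual_ball_fun p.1 x * dual_ball_fun p.2 y)
    \in @linf_pred R (dual_ball X * dual_ball Y)%type.
Proof.
rewrite inE; apply/linf_setP; exists (`|x| * `|y|) => -[[f f1] [g g1]] /=.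
rewrite normrM ler_pM// (le_trans (dual_le_norm _ _))// ler_piMl//.
Qed.

Definition tensor (x : X) (y : Y) : ambient := Linf (tensor_subproof x y).

Definition alg_tensor : set ambient :=
  [set u | exists (n : nat) (x : 'I_n -> X) (y : 'I_n -> Y),
             u = \sum_(i < n) tensor (x i) (y i)].

Lemma tensorZl a x y : tensor (a *: x) y = a *: tensor x y.
Proof. by apply: linfE => p; rewrite /= linearZ/= -scalerAl. Qed.

Lemma tensorZr a x y : tensor x (a *: y) = a *: tensor x y.
Proof. by apply: linfE => p; rewrite /= linearZ/= -scalerAr. Qed.

Lemma tensorDl x1 x2 y : tensor (x1 + x2) y = tensor x1 y + tensor x2 y.
Proof. by apply: linfE => p; rewrite /= linearD/= mulrDl. Qed.

Lemma tensorDr x y1 y2 : tensor x (y1 + y2) = tensor x y1 + tensor x y2.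
Proof. by apply: linfE => p; rewrite /= linearD/= mulrDr. Qed.

Lemma alg_tensor_normE n (x : 'I_n -> X) (y : 'I_n -> Y) :
  `|\sum_(i < n) tensor (x i) (y i)| =
  sup [set `|\sum_(i < n) dual_ball_fun p.1 (x i) * dual_ball_fun p.2 (y i)|
      | p in [set: dual_ball X * dual_ball Y]].
Proof.
rewrite linf_normE; congr sup; apply: eq_imagel => p _; congr `|_|.
by elim/big_ind2 : _ => //= u a v b <- <-.
Qed.

Lemma alg_tensor0 : alg_tensor 0.
Proof. by exists 0%N, (fun=> 0), (fun=> 0); rewrite big_ord0. Qed.

Lemma alg_tensorZD a u v :
  alg_tensor u -> alg_tensor v -> alg_tensor (a *: u + v).
Proof.
move=> [n [x [y ->]]] [m [z [w ->]]].
exists (n + m)%N,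
  (fun i => match fintype.split i with inl j => a *: x j | inr j => z j end),
  (fun i => match fintype.split i with inl j => y j | inr j => w j end).
rewrite big_split_ord/= scaler_sumr; congr (_ + _); apply: eq_bigr => i _.
  by rewrite (unsplitK (inl i)) tensorZl.
by rewrite (unsplitK (inr i)).
Qed.

Definition itensor_pred : {pred ambient} := mem (closure alg_tensor).

Lemma itensor_predP u : u \in itensor_pred <->
  forall e, 0 < e -> exists2 v, alg_tensor v & `|u - v| < e.
Proof.
rewrite inE; split=> [cu e e0|cu B /nbhs_ballP[e /= e0 eB]].
  have [v [Av]] := cu _ (nbhsx_ballx u e e0).
  by rewrite -ball_normE /= => uv; exists v.
have [v Av uv] := cu e e0; exists v; split => //; apply: eB.
by rewrite -ball_normE.
Qed.

Fact itensor_submod_closed : submod_closed itensor_pred.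
Proof.
split=> [|a u v /itensor_predP uA /itensor_predP vA].
  by rewrite inE; apply: subset_closure; exact: alg_tensor0.
apply/itensor_predP => e e0.
have a0 : 0 < `|a| + 1 by rewrite ltr_wpDl.
have [u' Au' uu'] := uA (e / 2 / (`|a| + 1))
  (divr_gt0 (divr_gt0 e0 (ltr0Sn _ 1)) a0).
have [v' Av' vv'] := vA (e / 2) (divr_gt0 e0 (ltr0Sn _ 1)).
exists (a *: u' + v'); first exact: alg_tensorZD.
rewrite opprD addrACA -scalerBr (le_lt_trans (ler_normD _ _))//.
rewrite [e]splitr ler_ltD// normrZ.
rewrite (le_trans _ (_ : (`|a| + 1) * `|u - u'| <= _))//.
  by rewrite ler_wpM2r// lerDl.
by rewrite mulrC -ler_pdivlMr// ltW.
Qed.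

HB.instance Definition _ :=
  GRing.isSubmodClosed.Build R ambient itensor_pred itensor_submod_closed.

Record itensor : Type := Itensor {
  itensor_val :> ambient;
  itensor_valP : itensor_val \in itensor_pred }.

HB.instance Definition _ := [isSub for itensor_val].
HB.instance Definition _ := [Choice of itensor by <:].
HB.instance Definition _ := [SubChoice_isSubLmodule of itensor by <:].

Definition itensor_norm (u : itensor) : R := `|itensor_val u|.

Fact itensor_normD u v : itensor_norm (u + v) <= itensor_norm u + itensor_norm v.
Proof. exact: ler_normD. Qed.

Fact itensor_normZ (a : R) u : itensor_norm (a *: u) = `|a| * itensor_norm u.
Proof. exact: normrZ. Qed.

Fact itensor_norm0_eq0 u : itensor_norm u = 0 -> u = 0.
Proof. by move=> /normr0_eq0 u0; exact: val_inj. Qed.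

HB.instance Definition _ := @Lmodule_isNormed.Build R itensor
  itensor_norm itensor_normD itensor_normZ itensor_norm0_eq0.

Lemma itensor_normE (u : itensor) : `|u| = `|itensor_val u|.
Proof. by []. Qed.

Fact itensor_complete (F : set_system itensor) :
  ProperFilter F -> cauchy F -> cvg F.
Proof.
move=> FF /cauchy_ballP Fc.
have cF : cvg (itensor_val @ F).
  apply: cauchy_cvg; apply/cauchy_ballP => e e0.
  have [[A B] /= [FA FB] AB] := Fc _ e0.
  exists (itensor_val @` A, itensor_val @` B) => /=.
    split; [apply: (@filterS _ F _ A)|apply: (@filterS _ F _ B)] => // u ?;
    by exists u.
  move=> [_ _] [/= [u Au <-] [v Bv <-]].
  by have := AB (u, v) (conj Au Bv); rewrite -!ball_normE.
have lP : lim (itensor_val @ F) \in itensor_pred.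
  rewrite inE; apply: (@closed_cvg _ _ F _ itensor_val).
  - exact: closed_closure.
  - by apply: nearW => u; have := itensor_valP u; rewrite inE.
  - exact: cF.
apply/cvg_ex; exists (Itensor lP); apply/cvgrPdist_lt => e e0.
by have /cvgrPdist_lt/(_ e e0) := cF.
Qed.

HB.instance Definition _ := Uniform_isComplete.Build itensor itensor_complete.

End injective_tensor_product.

Definition linf_c {R : realType} (Gamma : Type) : set (linf R Gamma) :=
  [set f | countable [set g | f g != 0]].

(* An operator into the subspace [linf_c Gamma] is given as an operator into
   [linf R Gamma] with values in [linf_c Gamma]. *)
Definition wld {R : realType} (X : normedModType R) : Prop :=
  exists (Gamma : Type) (Phi : {linear dual X -> linf R Gamma}),
    [/\ inhabited Gamma,
        continuous Phi,
        (forall f, linf_c (Phi f)),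
        injective Phi &
        continuous (fun f : weakstar X => Phi f : {ptws Gamma -> R})].

Definition borel (K : ptopologicalType) := g_sigma_algebraType (@open K).

Local Open Scope ereal_scope.

(* Meant for compact Hausdorff K, where compact sets are Borel. *)
Definition regular_measure {R : realType} (K : ptopologicalType)
    (mu : {measure set (borel K) -> \bar R}) : Prop :=
  forall A : set (borel K), measurable A ->
    mu A = ereal_sup [set mu C | C in [set C : set K | compact C /\ C `<=` A]] /\
    mu A = ereal_inf [set mu U | U in [set U : set K | open U /\ A `<=` U]].

Definition measure_support {R : realType} (K : ptopologicalType)
    (mu : {measure set (borel K) -> \bar R}) : set K :=
  [set x | forall U : set K, open U -> U x -> 0 < mu U].

Definition separable_set (K : topologicalType) (S : set K) : Prop :=
  exists D : set K, [/\ countable D, D `<=` S & S `<=` closure D].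

Definition property_M (R : realType) (K : ptopologicalType) : Prop :=
  forall mu : probability (borel K) R,
    regular_measure mu -> separable_set (measure_support mu).

(* Main.v *)
Require Import Defs.
From HB Require Import structures.
From mathcomp Require Import all_boot all_order all_algebra.
From mathcomp Require Import all_classical all_reals all_analysis.
From mathcomp Require Import measurable_realfun ring lra.

(* WLD means that X contains a total family x_i such that every functional is
   nonzero at only countably many x_i.

   If X is WLD with property (M), the family of all x_i (x) x_j works for the
   tensor square. By Hahn-Banach a functional f on it extends to all bounded
   functions on K x K, with K the dual ball. The variation of the extension,
   read off on the sets A x K, is a finitely additive measure on K, and it
   regularizes to a Radon probability. The support of that probability is
   separable, so only countably many x_i are nonzero on it; for every other i
   the functions x_i (x) y are negligible, hence killed by f. The second factor
   is treated in the same way.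

   Conversely, slicing the tensor square by a functional on the second factor
   shows that X is WLD. For a regular probability mu on K let
   phi(u) = \int u(k, k) dmu(k). It is a pointwise limit of integrals over
   step maps, which only involve finitely many points of K and so are nonzero
   at only countably many x_i (x) x_i. Countable tightness of the dual ball of
   a WLD space transfers this to phi. But phi(x_i (x) x_i) = \int x_i^2 dmu is
   positive as soon as x_i does not vanish on the support of mu, so countably
   many x_i separate the points of the support, which is compact, hence
   separable. *)

Set Implicit Arguments.
Unset Strict Implicit.
Unset Printing Implicit Defensive.
Import Order.TTheory GRing.Theory Num.Theory.
Import numFieldNormedType.Exports.
Local Open Scope classical_set_scope.
Local Open Scope ring_scope.

(** * The Hahn-Banach theorem *)

(* Partial functionals are encoded by their graphs; a linear graph below a
   sublinear [p] is automatically single-valued. *)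
Definition lin_graph {R : realType} {V : lmodType R} (G : set (V * R)) :=
  G (0, 0) /\ forall (a : R) u r v s, G (u, r) -> G (v, s) -> G (a *: u + v, a * r + s).

(** A value [a] at [v] keeps the graph below [p] as soon as [r - p (u - v) <= a <= p (w + v) - s]
    for all [(u, r)] and [(w, s)] in [G]. Subadditivity puts every such lower bound below every such
    upper bound, and the supremum of the lower bounds is taken. *)
Lemma lin_graph_extend {R : realType} {V : lmodType R} (p : V -> R)
    (G : set (V * R)) (v : V) :
  (forall x y, p (x + y) <= p x + p y) ->
  (forall a x, 0 <= a -> p (a *: x) = a * p x) ->
  lin_graph G -> (forall u r, G (u, r) -> r <= p u) ->
  exists G' : set (V * R), [/\ lin_graph G', G `<=` G',
    (forall u r, G' (u, r) -> r <= p u) & exists a, G' (v, a)].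
Proof.
move=> pD pZ [G0 Glin] Gp.
have key u r w s : G (u, r) -> G (w, s) -> r - p (u - v) <= p (w + v) - s.
  move=> Gu Gw.
  have := Gp _ _ (Glin 1 _ _ _ _ Gu Gw); rewrite scale1r mul1r => rs.
  have := pD (u - v) (w + v); rewrite addrACA addNr addr0 => ?; lra.
pose L := [set x | exists u r, G (u, r) /\ x = r - p (u - v)].
have supL : has_sup L.
  split; first by exists (0 - p (0 - v)), 0, 0.
  by exists (p (0 + v) - 0) => _ [u [r [Gu ->]]]; exact: key.
pose a := sup L.
have aL u r : G (u, r) -> r - p (u - v) <= a.
  by move=> Gu; apply: ub_le_sup; [case: supL|exists u, r].
have aU w s : G (w, s) -> a <= p (w + v) - s.
  move=> Gw; apply: ge_sup; first by case: supL.
  by move=> _ [u [r [Gu ->]]]; exact: key.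
have Gs (c : R) u r : G (u, r) -> G (c *: u, c * r).
  by move=> Gu; have := Glin c _ _ _ _ Gu G0; rewrite !addr0.
exists [set x | exists u r t, G (u, r) /\ x = (u + t *: v, r + t * a)].
split.
- split; first by exists 0, 0, 0; rewrite scale0r mul0r !addr0.
  move=> c u r w s [u1 [r1 [t1 [G1 [-> ->]]]]] [u2 [r2 [t2 [G2 [-> ->]]]]].
  exists (c *: u1 + u2), (c * r1 + r2), (c * t1 + t2); split; first exact: Glin.
  congr pair; last by ring.
  by rewrite scalerDr scalerA scalerDl addrACA.
- by move=> [u r] Gu; exists u, r, 0; rewrite scale0r mul0r !addr0.
- move=> _ _ [u [r [t [Gu [-> ->]]]]].
  have [t0|t0|->] := ltgtP t 0; last by rewrite scale0r mul0r !addr0; exact: Gp.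
  + have nt : 0 < - t by rewrite oppr_gt0.
    have := aL _ _ (Gs (- t)^-1 _ _ Gu).
    rewrite -(ler_pM2l nt) mulrBr mulrA divff ?gt_eqF// mul1r -pZ ?(ltW nt)//.
    rewrite scalerBr scalerA divff ?gt_eqF// scale1r scaleNr opprK => ?; lra.
  + have := aU _ _ (Gs t^-1 _ _ Gu).
    rewrite -(ler_pM2l t0) mulrBr mulrA divff ?gt_eqF// mul1r -pZ ?(ltW t0)//.
    rewrite scalerDr scalerA divff ?gt_eqF// scale1r => ?; lra.
- by exists a, 0, 0, 1; rewrite scale1r mul1r !add0r.
Qed.

Theorem hahn_banach {R : realType} {V : lmodType R} (p : V -> R)
    (G : set (V * R)) :
  (forall x y, p (x + y) <= p x + p y) ->
  (forall a x, 0 <= a -> p (a *: x) = a * p x) ->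
  lin_graph G -> (forall u r, G (u, r) -> r <= p u) ->
  exists g : V -> R, [/\ linear g, (forall v, g v <= p v) &
    forall u r, G (u, r) -> g u = r].
Proof.
move=> pD pZ Glin Gp.
(* The conditions bear on the union with [G], so that the empty chain, whose union is empty, also
   has an upper bound in [P]. *)
pose P := [set H : set (V * R) | lin_graph (G `|` H) /\
   forall u r, (G `|` H) (u, r) -> r <= p u].
have [F FP Ftot|M [[Mlin Mp] Mmax]] := @Zorn_bigcup _ P.
  rewrite /P /=; have PF u r : (G `|` \bigcup_(X in F) X) (u, r) ->
      exists2 H, (H = set0 \/ F H) & (G `|` H) (u, r).
    move=> [Gu|[H FH Hu]]; first by exists set0; left.
    by exists H; right.
  have PH H : (H = set0 \/ F H) -> P H.
    move=> [->|/FP//]; split; first by rewrite setU0.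
    by move=> u r [/Gp|].
  have HF H : (H = set0 \/ F H) -> G `|` H `<=` G `|` \bigcup_(X in F) X.
    move=> [->|FH x [Gx|Hx]]; first by rewrite setU0; exact: subsetUl.
      by left.
    by right; exists H.
  split; last first.
    by move=> u r /PF[H FH Hu]; have [_] := PH _ FH; apply.
  split; first by left; case: Glin.
  move=> a u r v s /PF[H FH Hu] /PF[K FK Kv].
  have [HK|KH] : (H `<=` K) \/ (K `<=` H).
    case: FH => [->|FH]; first by left; exact: sub0set.
    case: FK => [->|FK]; first by right; exact: sub0set.
    exact: Ftot.
    apply: (HF _ FK); have [[_ lin] _] := PH _ FK; apply: lin => //.
    by move: Hu => [|/HK]; [left|right].
  apply: (HF _ FH); have [[_ lin] _] := PH _ FH; apply: lin => //.
  by move: Kv => [|/KH]; [left|right].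
set H := G `|` M in Mlin Mp.
have dom v : exists a, H (v, a).
  have [H' [H'lin HH' H'p [a Ha]]] := lin_graph_extend v pD pZ Mlin Mp.
  exists a; right; apply: contrapT => nMa; apply: (Mmax H').
    split; first by move=> x Mx; apply: HH'; right.
    by move/(_ _ Ha).
  have -> : P H' = (lin_graph (G `|` H') /\
     forall u r, (G `|` H') (u, r) -> r <= p u) by [].
  by rewrite (_ : G `|` H' = H')//; apply/setUidPr => x Gx; apply: HH'; left.
have p0 : p 0 = 0 by have := pZ 0 0 (lexx _); rewrite scale0r mul0r.
have uniq u r s : H (u, r) -> H (u, s) -> r = s.
  (* By linearity the graph contains [(0, b - a)], and [p 0 = 0]. *)
  have le a b : H (u, a) -> H (u, b) -> b <= a.
    move=> Ha Hb; have [_ /(_ (-1) _ _ _ _ Ha Hb)] := Mlin.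
    by rewrite scaleN1r addNr => /Mp; rewrite p0 => ?; lra.
  by move=> Hr Hs; apply/eqP; rewrite eq_le !le.
pose g v := projT1 (cid (dom v)).
have gP v : H (v, g v) by rewrite /g; case: cid.
exists g; split.
- move=> a u v; apply: (uniq (a *: u + v)) => //.
  by have [_] := Mlin; apply.
- by move=> v; exact: Mp.
- by move=> u r Gu; apply: (uniq u) => //; left.
Qed.

Lemma linear_fun0 {R : realType} {U V : lmodType R} (f : U -> V) :
  linear f -> f 0 = 0.
Proof. by move=> lf; have := lf (-1) 0 0; rewrite scaler0 addr0 scaleN1r addNr. Qed.

Lemma dual_of_bounded {R : realType} (X : normedModType R) (f : X -> R) (M : R) :
  linear f -> 0 <= M -> (forall x, `|f x| <= M * `|x|) ->
  exists2 g : dual X, (g : X -> R) = f & `|g| <= M.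
Proof.
move=> lf M0 fM.
pose lfM := GRing.isLinear.Build R X R *:%R f lf.
pose F : {linear X -> R} := HB.pack f lfM.
have cF : continuous F.
  apply/bounded_linear_continuous/linear_boundedP; near=> r => x.
  by rewrite (le_trans (fM x))// ler_wpM2r.
have fd : f \in @dual_pred R X by rewrite inE.
exists (Dual fd) => //.
by apply: dual_norm_le => x x1; rewrite (le_trans (fM x))// ler_piMr.
Unshelve. all: by end_near. Qed.

Lemma dual_norming {R : realType} (X : normedModType R) (x : X) :
  exists2 f : dual X, `|f| <= 1 & f x = `|x|.
Proof.
have [||||g [lg gle gx]] := @hahn_banach R X (fun x => `|x|)
    [set z | exists t : R, z = (t *: x, t * `|x|)].
- by move=> u v; exact: ler_normD.
- by move=> a u a0; rewrite normrZ ger0_norm.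
- split; first by exists 0; rewrite scale0r mul0r.
  move=> a u r v s [t [-> ->]] [t' [-> ->]]; exists (a * t + t').
  by rewrite scalerDl scalerA mulrDl mulrA.
- by move=> u r [t [-> ->]]; rewrite normrZ ler_wpM2r// ler_norm.
have gN u : g (- u) = - g u.
  by have := lg (-1) u 0; rewrite !addr0 (linear_fun0 lg) addr0 !scaleN1r.
have [//|u|f fg f1] := @dual_of_bounded R X g 1 lg.
  by rewrite mul1r ler_norml gle lerNl -gN -(normrN u) gle.
by exists f => //; rewrite fg; apply: gx; exists 1; rewrite scale1r mul1r.
Qed.

Lemma dual_extension {R : realType} (Z E : normedModType R) (i : Z -> E)
    (f : dual Z) : linear i -> (forall z, `|i z| = `|z|) ->
  exists2 g : dual E, `|g| <= `|f| & forall z, g (i z) = f z.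
Proof.
move=> li iN.
have [||||g [lg gle gx]] := @hahn_banach R E (fun x => `|f| * `|x|)
    [set u | exists z, u = (i z, f z)].
- by move=> u v; rewrite -mulrDr ler_wpM2l// ler_normD.
- by move=> a u a0; rewrite normrZ ger0_norm// mulrCA.
- split; first by exists 0; rewrite (linear_fun0 li) linear0.
  move=> a u r v s [z [-> ->]] [w [-> ->]]; exists (a *: z + w).
  by rewrite li linearP.
- by move=> u r [z [-> ->]]; rewrite iN (le_trans (ler_norm _))// dual_le_norm.
have gN u : g (- u) = - g u.
  by have := lg (-1) u 0; rewrite !addr0 (linear_fun0 lg) addr0 !scaleN1r.
have [//|u|h hg h1] := @dual_of_bounded R E g `|f| lg.
  by rewrite ler_norml gle lerNl -gN -(normrN u) gle.
by exists h => // z; rewrite hg; apply: gx; exists z.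
Qed.

(** * The weak-star compact dual ball *)

(** The topology of the dual ball is a stack of initial topologies; this peels off one layer at a
    time, down to evaluations at points. *)
Lemma initial_cvg {S : choiceType} {T : topologicalType} (f : S -> T)
    (F : set_system S) (s : S) :
  Filter F -> f @ F --> f s -> F --> (s : initial_topology f).
Proof.
move=> FF Ffs A; rewrite nbhsE => -[_ [[B oB <-] Bs] BA].
by apply: (filterS BA); apply: Ffs; exact: open_nbhs_nbhs.
Qed.

Lemma dual_ball_cvg {R : realType} (X : normedModType R)
    (F : set_system (dual_ball X)) (g : dual_ball X) :
  Filter F ->
  (forall x, (fun f => dual_ball_fun f x) @ F --> dual_ball_fun g x) -> F --> g.
Proof.
move=> FF Fg.
apply: (@initial_cvg (dual_ball X) (weakstar X) (@dual_ball_fun R X) F g FF).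
apply: (@initial_cvg (dual X) {ptws X -> R} (@dual_fun R X)).
apply/cvg_sup => x.
apply: (@initial_cvg (X -> R) R (fun f : X -> R => f x)); exact: Fg.
Qed.

Lemma dual_ball_eval_continuous {R : realType} (X : normedModType R) (x : X) :
  continuous (fun f : dual_ball X => dual_ball_fun f x).
Proof.
by move: x; apply: (dual_ball_continuousP (@id (dual_ball X))).1 => f; exact: cvg_id.
Qed.

Lemma dual_ball_inj {R : realType} (X : normedModType R) (f g : dual_ball X) :
  (forall x, dual_ball_fun f x = dual_ball_fun g x) -> f = g.
Proof. by move=> fg; apply/val_inj/dualE. Qed.

Lemma dual_ball_le {R : realType} (X : normedModType R) (f : dual_ball X) x :
  `|dual_ball_fun f x| <= `|x|.
Proof. by rewrite (le_trans (dual_le_norm _ _))// ler_piMl// (valP f). Qed.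

Lemma dual_ball_hausdorff {R : realType} (X : normedModType R) :
  hausdorff_space (dual_ball X).
Proof.
move=> f g fg; apply: dual_ball_inj => x; apply: contrapT => /eqP neq.
have d0 : 0 < `|dual_ball_fun f x - dual_ball_fun g x| / 2.
  by rewrite divr_gt0 ?normr_gt0 ?subr_eq0.
have /cvgrPdist_lt/(_ _ d0) cf := @dual_ball_eval_continuous R X x f.
have /cvgrPdist_lt/(_ _ d0) cg := @dual_ball_eval_continuous R X x g.
have [h [/= fh gh]] := fg _ _ cf cg.
have := ler_normD (dual_ball_fun f x - dual_ball_fun h x)
  (dual_ball_fun h x - dual_ball_fun g x).
rewrite addrA subrK (distrC (dual_ball_fun h x)) => ?; lra.
Qed.

(** Along an ultrafilter the values at [x] stay in the compact interval from [- |x|] to [|x|], hence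
    converge. The pointwise limit inherits linearity and the norm bound. *)
Theorem banach_alaoglu {R : realType} (X : normedModType R) :
  compact [set: dual_ball X].
Proof.
rewrite compact_ultra => F FU _.
have lim x : exists l : R, (fun f => dual_ball_fun f x) @ F --> l.
  have [|l [_ cl]] := @segment_compact R (- `|x|) `|x|
      ((fun f => dual_ball_fun f x) @ F) _.
    by apply: nearW => f /=; rewrite in_itv/= -ler_norml dual_ball_le.
  exists l => U Ul; rewrite /fmap/=.
  have [//|FC] := in_ultra_setVsetC ((fun f => dual_ball_fun f x) @^-1` U) FU.
  have [r [/= nUr Ur]] := cl (~` U) U FC Ul.
  by [].
pose l x := projT1 (cid (lim x)).
have lP x : (fun f => dual_ball_fun f x) @ F --> l x by rewrite /l; case: cid.
have [a x y||x|g gl g1] := @dual_of_bounded R X l 1.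
- have /cvg_lim <- // := lP (a *: x + y).
  apply/cvg_lim => //.
  rewrite (_ : (fun _ => _) =
      (fun f => a *: dual_ball_fun f x + dual_ball_fun f y)); last first.
    by apply/funext => f; rewrite linearP.
  by apply: cvgD => //; apply: cvgZr.
- by [].
- rewrite mul1r; apply: (@closed_cvg _ _ F _ (fun f => dual_ball_fun f x)
    (fun r => `|r| <= `|x|)) (lP x).
    rewrite (_ : (fun r => _) = closed_ball_ Num.norm (0 : R) `|x|).
      exact: closed_closed_ball_.
    by apply/funext => r; rewrite /closed_ball_ /= distrC subr0.
  by apply: nearW => f; exact: dual_ball_le.
- exists (exist _ g g1); split => //; apply: dual_ball_cvg => x /=.
  by rewrite gl.
Qed.

(* The sequence clusters somewhere by compactness, and the total family [x]
   forces the cluster point to be [s]. *)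
Lemma dual_ball_cluster {R : realType} (X : normedModType R) (I : Type)
    (x : I -> X) (t : nat -> dual_ball X) (s : dual_ball X) :
  (forall f : dual X, (forall i, f (x i) = 0) -> f = 0) ->
  (forall i, (fun n => dual_ball_fun (t n) (x i)) @ \oo --> dual_ball_fun s (x i)) ->
  cluster (t @ \oo) s.
Proof.
move=> tot ts.
have [p [_ tp]] := @banach_alaoglu R X (t @ \oo) _ filterT.
rewrite (_ : s = p)//; apply: dual_ball_inj => z; apply/eqP.
rewrite -subr_eq0; apply/eqP.
have : dual_ball_fun s - dual_ball_fun p = 0.
  apply: tot => i; apply: contrapT => /eqP neq.
  have d0 : 0 < `|dual_ball_fun s (x i) - dual_ball_fun p (x i)| / 2.
    by rewrite divr_gt0 ?normr_gt0.
  have /cvgrPdist_lt/(_ _ d0) cp := @dual_ball_eval_continuous R X (x i) p.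
  have /cvgrPdist_lt/(_ _ d0) cs := ts i.
  have [h [/= sh ph]] := tp [set h | `|dual_ball_fun s (x i) - dual_ball_fun h (x i)|
     < `|dual_ball_fun s (x i) - dual_ball_fun p (x i)| / 2] _ cs cp.
  have := ler_normD (dual_ball_fun s (x i) - dual_ball_fun h (x i))
    (dual_ball_fun h (x i) - dual_ball_fun p (x i)).
  rewrite addrA subrK (distrC (dual_ball_fun h (x i))) => ?; lra.
by move=> /(congr1 (fun f : dual X => f z)).
Qed.

(** * Total families in WLD spaces *)

Lemma weakstar_eval_continuous {R : realType} (X : normedModType R) (x : X) :
  continuous (fun f : weakstar X => (f : dual X) x).
Proof.
by move: x; apply: (weakstar_continuousP (@id (weakstar X))).1 => f; exact: cvg_id.
Qed.

Lemma evaluation_of_finite_kernel {R : realType} (X : normedModType R)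
    (xs : seq X) (L : dual X -> R) : linear L ->
  (forall f : dual X, (forall x, x \in xs -> f x = 0) -> L f = 0) ->
  exists x, forall f, L f = f x.
Proof.
elim: xs L => [|x xs ih] L lL kL.
  by exists 0 => f; rewrite linear0 kL.
have [kL'|/existsNP[f0 /not_implyP[f00 Lf0]]] := pselect (forall f : dual X,
  (forall x, x \in xs -> f x = 0) -> L f = 0); first exact: ih.
have L0 : L 0 = 0 := linear_fun0 lL.
have LB a u v : L (u - a *: v) = L u - a * L v.
  by rewrite addrC -scaleNr lL addrC; congr (_ + _); exact: mulNr.
have f0x : f0 x != 0.
  apply/eqP => f0x; apply: Lf0; apply: kL => y.
  by rewrite inE => /orP[/eqP->//|]; exact: f00.
(* The corrected functional takes at [f] the value of [L] at [f - (f x / f0 x) *: f0], which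
   vanishes at [x]. It is therefore zero on the common kernel of [xs] alone. *)
have [||y Ly] := ih (fun f => L f - L f0 / f0 x * f x).
- by move=> a u v; rewrite lL -[(a *: u + v) x]/(a * u x + v x) /GRing.scale/=; ring.
- move=> f fxs; have : L (f - (f x / f0 x) *: f0) = 0.
    apply: kL => z; rewrite inE => /orP[/eqP->|zxs].
      by rewrite -[LHS]/(f x - f x / f0 x * f0 x) divfK// subrr.
    by rewrite -[LHS]/(f z - f x / f0 x * f0 z) (fxs z zxs) (f00 z zxs) mulr0 subrr.
  by rewrite LB => <-; field.
exists (y + (L f0 / f0 x) *: x) => f.
by rewrite linearD linearZ/= -Ly /GRing.scale/= subrK.
Qed.

(** Continuity at 0 bounds [L] by 1 on a basic neighbourhood given by finitely many points. Their
    common kernel is a subspace inside this neighbourhood, so scaling forces [L] to vanish on it. *)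
Lemma evaluation_of_weakstar_continuous {R : realType} (X : normedModType R)
    (L : dual X -> R) : linear L -> continuous (L : weakstar X -> R) ->
  exists x, forall f, L f = f x.
Proof.
move=> lL cL.
have L0 : L 0 = 0 := linear_fun0 lL.
pose B (p : seq X * R) := [set f : dual X | forall x, x \in p.1 -> `|f x| < p.2].
pose F : set_system (dual X) := filter_from [set p : seq X * R | 0 < p.2] B.
have FF : Filter F.
  apply: filter_from_filter; first by exists ([::], 1); rewrite /= ltr01.
  move=> [xs e] [ys d] /= e0 d0; exists (xs ++ ys, Num.min e d).
    by rewrite /= lt_min e0.
  move=> f /= fB; split=> x /= xs_; have := fB x; rewrite mem_cat xs_ ?orbT;
    by move=> /(_ isT); rewrite lt_min => /andP[].
have F0 : F --> (0 : weakstar X).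
  apply: (@initial_cvg (dual X) {ptws X -> R} (@dual_fun R X)).
  apply/cvg_sup => x.
  apply: (@initial_cvg (X -> R) R (fun f : X -> R => f x)).
  apply/cvgrPdist_lt => e e0; exists ([:: x], e) => // f /= fB.
  by rewrite sub0r normrN; apply: fB; rewrite inE.
have LF : L @ F --> L 0 by apply: cvg_trans (cL 0); exact: cvg_app F0.
have [[xs e] /= e0 sub] := (cvgrPdist_lt _ _).1 LF 1 ltr01.
apply: (@evaluation_of_finite_kernel R X xs L lL) => f fxs.
apply: contrapT => /eqP Lf.
have BL : B (xs, e) ((2 / L f) *: f).
  by move=> x xxs; rewrite -[X in `|X|]/(2 / L f * f x) fxs// mulr0 normr0.
have := sub _ BL; rewrite /= L0 sub0r normrN.
have -> : L ((2 / L f) *: f) = 2.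
  by have := lL (2 / L f) f 0; rewrite L0 !addr0 => ->; exact: divfK.
by rewrite ger0_norm// ltNge ler1n.
Qed.

(** The coordinates of [Phi] are weak-star continuous functionals on the dual, hence evaluations at
    points of [X]. From here on WLD is only used in this form. *)
Lemma wldP {R : realType} (X : normedModType R) :
  wld X <-> exists (Gamma : Type) (x : Gamma -> X),
    [/\ inhabited Gamma,
        (forall f : dual X, countable [set g | f (x g) != 0]) &
        (forall f : dual X, (forall g, f (x g) = 0) -> f = 0)].
Proof.
split=> [[Gamma [Phi [inh cPhi Phic Phi_inj Phiw]]]|[Gamma [x [inh xc xtot]]]].
  have ev g : exists x, forall f, Phi f g = f x.
    apply: (@evaluation_of_weakstar_continuous R X (fun f => Phi f g)).
      by move=> a u v; rewrite linearP.
    by move: g; apply/(ptws_continuousP (fun f : weakstar X => Phi f : Gamma -> R)).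
  pose x g := projT1 (cid (ev g)).
  have xP f g : Phi f g = f (x g) by rewrite /x; case: cid.
  exists Gamma, x; split => //.
    move=> f; have := Phic f; rewrite /linf_c/=; apply: sub_countable.
    by apply: subset_card_le => g /=; rewrite xP.
  move=> f fx; apply: Phi_inj; rewrite linear0; apply: linfE => g.
  by rewrite xP fx.
(* Rescaling into the unit ball makes the operator bounded and changes no support; the added 1
   allows [x g = 0]. *)
pose y g := (1 + `|x g|)^-1 *: x g.
have c0 g : 0 < (1 + `|x g|)^-1 by rewrite invr_gt0 ltr_wpDr.
have y1 g : `|y g| <= 1.
  by rewrite normrZ gtr0_norm// mulrC ler_pdivrMr ?mul1r ?lerDr//.
have fy (f : dual X) g : `|f (y g)| <= `|f|.
  rewrite (le_trans (dual_le_norm f _))//; apply: ler_piMr; [exact: dual_norm_ge0|exact: y1].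
have fbd (f : dual X) : (fun g => f (y g)) \in @linf_pred R Gamma.
  by rewrite inE; apply/linf_setP; exists `|f|.
pose Phi f : linf R Gamma := Linf (fbd f).
have lPhi : linear Phi by move=> a u v; apply: linfE.
pose lPhiM := GRing.isLinear.Build R (dual X) (linf R Gamma) *:%R Phi lPhi.
pose PhiL : {linear dual X -> linf R Gamma} := HB.pack Phi lPhiM.
have y0 (f : dual X) g : (f (y g) != 0) = (f (x g) != 0).
  by rewrite /y linearZ/= mulf_eq0 gt_eqF.
exists Gamma, PhiL; split => //.
- apply/bounded_linear_continuous/linear_boundedP; near=> r => f.
  rewrite (@le_trans _ _ `|f|)//.
    by apply: linf_norm_le => [|g]; [exact: dual_norm_ge0|exact: fy].
  by rewrite ler_peMl.
- move=> f; rewrite /linf_c/=; apply: sub_countable (xc f).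
  by apply: subset_card_le => g /=; rewrite y0.
- move=> f h fh; apply/eqP; rewrite -subr_eq0; apply/eqP; apply: xtot => g.
  apply/eqP; rewrite -[_ == _]negbK -y0 negbK.
  rewrite -[X in X == _]/(f (y g) - h (y g)) subr_eq0; apply/eqP.
  by have := congr1 (fun u : linf R Gamma => u g) fh.
- apply/(ptws_continuousP (fun f : weakstar X => Phi f : Gamma -> R)) => g.
  exact: weakstar_eval_continuous.
Unshelve. all: by end_near. Qed.

(** * Radon probabilities from finitely additive measures *)

Section charge_regularization.
Context {R : realType} (K : ptopologicalType) (m : set K -> R).
Context (K_hausdorff : hausdorff_space K) (K_compact : compact [set: K]).
Context (m_ge0 : forall A, 0 <= m A).
Context (mU : forall A B, A `&` B = set0 -> m (A `|` B) = m A + m B).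

Local Open Scope ereal_scope.

(* The inner content of [m] on open sets; [m] itself need not be continuous
   from below on them. *)
Let open_val (U : set K) : \bar R :=
  ereal_sup [set (m C)%:E | C in [set C | closed C /\ C `<=` U]].

Let outer (A : set K) : \bar R :=
  ereal_inf [set open_val U | U in [set U | open U /\ A `<=` U]].

Let m_le A B : A `<=` B -> (m A <= m B)%R.
Proof.
move=> AB; rewrite -(setDUK AB) mU ?lerDl//.
by rewrite setDE setIA setIAC setICr set0I.
Qed.

Let m0 : m set0 = 0%R.
Proof.
have := mU (setI0 (@set0 K)); rewrite setU0 => /eqP.
by rewrite addrC -subr_eq subrr eq_sym => /eqP.
Qed.

Let le_open_val U V : U `<=` V -> open_val U <= open_val V.
Proof.
move=> UV; apply: ge_ereal_sup => _ [C [cC CU] <-].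
by apply: ereal_sup_ubound; exists C => //; split => //; exact: subset_trans UV.
Qed.

Let closed_le_open_val C U : closed C -> C `<=` U -> (m C)%:E <= open_val U.
Proof. by move=> cC CU; apply: ereal_sup_ubound; exists C. Qed.

Let open_val_ge0 U : 0 <= open_val U.
Proof. by rewrite -[0]/((0%R)%:E) -m0; apply: closed_le_open_val => //; exact: closed0. Qed.

Let open_val_le U : open_val U <= (m setT)%:E.
Proof. by apply: ge_ereal_sup => _ [C [cC CU] <-]; rewrite lee_fin m_le. Qed.

(** Normality separates [C \ V] and [C \ U] by disjoint open [P] and [Q]. Then [C \ Q] is a closed
    part of [U], and the rest of [C] lies in the closed part [C \ P] of [V]. *)
Let open_valU U V : open U -> open V ->
  open_val (U `|` V) <= open_val U + open_val V.
Proof.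
move=> oU oV; apply: ge_ereal_sup => _ [C [cC CUV] <-].
have [|||P [Q [oP oQ CP CQ PQ]]] := (@normal_openP R _).1
  (compact_normal K_hausdorff K_compact) (C `\` V) (C `\` U).
- by rewrite setDE; apply: closedI => //; exact: open_closedC.
- by rewrite setDE; apply: closedI => //; exact: open_closedC.
- rewrite -subset0 => x [[Cx nVx] [_ nUx]].
  by have [] := CUV x Cx.
have D1 : C `\` Q `<=` U.
  by move=> x [Cx nQx]; apply: contrapT => nUx; apply: nQx; exact: CQ.
have D2 : C `&` Q `<=` C `\` P.
  move=> x [Cx Qx]; split => // Px.
  by have : (P `&` Q) x by []; rewrite PQ.
have D3 : C `\` P `<=` V.
  by move=> x [Cx nPx]; apply: contrapT => nVx; apply: nPx; exact: CP.
have -> : C = (C `\` Q) `|` (C `&` Q) by rewrite setUC setUIDK.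
rewrite mU; last first.
  by rewrite setDE -setIA (setIA (~` Q)) (setIC (~` Q)) -setIA setICl !setI0.
rewrite EFinD leeD//.
  by apply: closed_le_open_val => //; rewrite setDE; apply: closedI => //;
    exact: open_closedC.
apply: (@le_trans _ _ (m (C `\` P))%:E); first by rewrite lee_fin m_le.
by apply: closed_le_open_val => //; rewrite setDE; apply: closedI => //;
    exact: open_closedC.
Qed.

(** Countable subadditivity comes from compactness alone: a closed set inside the union lies in
    finitely many of the [U n]. *)
Let open_val_bigcup (U : nat -> set K) : (forall n, open (U n)) ->
  open_val (\bigcup_n U n) <= \sum_(n <oo) open_val (U n).
Proof.
move=> oU; have fin n : open (\bigcup_(i < n) U i) /\
    open_val (\bigcup_(i < n) U i) <= \sum_(0 <= i < n) open_val (U i).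
  elim: n => [|n [oUn ih]].
    rewrite II0 bigcup_set0 big_geq//; split; first exact: open0.
    apply: ge_ereal_sup => r [C [_]]; rewrite subset0 => -> <-.
    by rewrite m0.
  rewrite IIS bigcup_setU bigcup_set1 big_nat_recr//=; split.
    exact: openU.
  by apply: le_trans (open_valU _ _) _ => //; rewrite leeD2r.
apply: ge_ereal_sup => _ [C [cC CU] <-].
have := subclosed_compact cC K_compact (@subsetT _ _).
rewrite compact_cover => /(_ nat setT U) [//|//|D _ CD].
pose N := (\max_(i <- finmap.enum_fset D) i).+1.
have CN : C `<=` \bigcup_(i < N) U i.
  move=> x /CD [i /= iD Uix]; exists i => //=.
  by rewrite /N ltnS; apply: (@leq_bigmax_seq _ _ xpredT id).
apply: le_trans (closed_le_open_val cC CN) _.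
by apply: le_trans (fin N).2 _; apply: nneseries_lim_ge => n _ _.
Qed.

Let outer_open U : open U -> outer U = open_val U.
Proof.
move=> oU; apply/eqP; rewrite eq_le; apply/andP; split.
  by apply: ereal_inf_lbound; exists U => //; split.
by apply: le_ereal_inf_tmp => _ [V [oV UV] <-]; exact: le_open_val.
Qed.

Let outer_ge0 A : 0 <= outer A.
Proof. by apply: le_ereal_inf_tmp => _ [V _ <-]; exact: open_val_ge0. Qed.

Let le_outer A B : A `<=` B -> outer A <= outer B.
Proof.
move=> AB; apply: le_ereal_inf_tmp => _ [V [oV UV] <-].
by apply: ereal_inf_lbound; exists V => //; split => //; exact: subset_trans UV.
Qed.

Let outer0 : outer set0 = 0.
Proof.
rewrite outer_open; last exact: open0.
apply/eqP; rewrite eq_le open_val_ge0 andbT.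
apply: ge_ereal_sup => r [C [_]]; rewrite subset0 => -> <-.
by rewrite m0.
Qed.

Let outer_le A : outer A <= (m setT)%:E.
Proof.
by apply: le_trans (le_outer (@subsetT _ A)) _; rewrite outer_open//; exact: openT.
Qed.

Let outer_fin A : outer A \is a fin_num.
Proof. by rewrite ge0_fin_numE// (le_lt_trans (outer_le A))// ltry. Qed.

Let outer_adherent A (e : R) : (0 < e)%R ->
  exists U, [/\ open U, A `<=` U & open_val U <= outer A + e%:E].
Proof.
move=> e0; have [_ [U [oU AU] <-] Ue] := lb_ereal_inf_adherent e0 (outer_fin A).
by exists U; split => //; exact: ltW.
Qed.

Let outer_sigma_subadditive : measure_extension.sigma_subadditive outer.
Proof.
move=> A; apply/lee_addgt0Pr => e e0.
have [U UP] : {U : nat -> set K & forall n, [/\ open (U n), A n `<=` U n &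
    open_val (U n) <= outer (A n) + (e / (2 ^ n.+1)%:R)%:E]}.
  apply: (@choice _ _ (fun n V => [/\ open V, A n `<=` V &
    open_val V <= outer (A n) + (e / (2 ^ n.+1)%:R)%:E])) => n.
  by apply: outer_adherent; rewrite divr_gt0// ltr0n expn_gt0.
rewrite (le_trans _ (epsilon_trick _ _ _))//; last exact: ltW.
have AU : \bigcup_n A n `<=` \bigcup_n U n.
  by apply: subset_bigcup => n _; have [] := UP n.
apply: le_trans (le_outer AU) _.
rewrite outer_open; last by apply: bigcup_open => n _; have [] := UP n.
apply: le_trans (open_val_bigcup _) _; first by move=> n; have [] := UP n.
by apply: lee_nneseries => [n _ _//|n _]; have [] := UP n.
Qed.

Let mu0 : {outer_measure set K -> \bar R} := HB.pack outer
  (isOuterMeasure.Build R K outer outer0 outer_ge0 le_outer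
    outer_sigma_subadditive).

(** Inside an open [V], exhaust [V & U] by a closed [C], and then the open set [V \ C], which
    contains [V \ U], by a closed [D]. The disjoint union of [C] and [D] is closed in [V], and [m]
    is additive on it. *)
Let open_caratheodory U : open U -> mu0.-caratheodory U.
Proof.
move=> oU; apply: le_caratheodory_measurable => X.
apply: le_ereal_inf_tmp => _ [V [oV XV] <-].
apply: (@le_trans _ _ (outer (V `&` U) + outer (V `&` ~` U))).
  by apply: leeD; apply: le_outer; apply: setSI.
rewrite outer_open; last exact: openI.
rewrite -leeBrDr//; apply: ge_ereal_sup => _ [C [cC CVU] <-].
rewrite leeBrDr//.
have oVC : open (V `&` ~` C) by apply: openI => //; exact: closed_openC.
apply: (@le_trans _ _ ((m C)%:E + open_val (V `&` ~` C))).
  rewrite -outer_open// leeD2l//; apply: le_outer.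
  by apply: setIS; apply: subsetC => x /CVU[].
rewrite -leeBrDl//; apply: ge_ereal_sup => _ [D [cD DVC] <-].
rewrite leeBrDl// -EFinD -mU.
  apply: closed_le_open_val; first exact: closedU.
  by move=> x [/CVU[]|/DVC[]].
by rewrite -subset0 => x [Cx /DVC[_]]; apply.
Qed.

Let borel_caratheodory (A : set (borel K)) : measurable A -> mu0.-caratheodory A.
Proof.
apply: smallest_sub; last exact: open_caratheodory.
split; first exact: caratheodory_measurable_set0.
  by move=> X mX; rewrite setTD; exact: caratheodory_measurable_setC.
by move=> F mF; exact: caratheodory_measurable_bigcup.
Qed.

(** The measure need not agree with [m], even on closed sets. The comparison is what carries null
    sets back: a closed set inside a [mu]-null open set is [m]-null. *)
Theorem regular_probability_of_additive : m setT = 1%R ->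
  exists2 mu : probability (borel K) R, regular_measure mu &
    forall C U, closed C -> open U -> C `<=` U -> (m C)%:E <= mu U.
Proof.
move=> m1.
have mu_sigma : semi_sigma_additive (outer : set (borel K) -> \bar R).
  move=> F mF tF mUF.
  have mF' n : mu0.-cara.-measurable (F n) by exact: borel_caratheodory.
  apply: (@caratheodory_measure_sigma_additive R K mu0) => //.
  exact: borel_caratheodory.
pose muM := isMeasure.Build _ (borel K) R outer outer0 outer_ge0 mu_sigma.
pose mu1 : {measure set (borel K) -> \bar R} := HB.pack outer muM.
have muT : mu1 setT = 1.
  rewrite /mu1/= outer_open; last exact: openT.
  apply/eqP; rewrite eq_le; apply/andP; split.
    by rewrite (le_trans (open_val_le _))// m1.
  rewrite -[1]/(1%R%:E) -m1; apply: closed_le_open_val => //; exact: closedT.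
pose muP := Measure_isProbability.Build _ (borel K) R mu1 muT.
pose mu : probability (borel K) R := HB.pack outer muM muP.
exists mu; last first.
  by move=> C U cC oU CU; rewrite /= outer_open//; exact: closed_le_open_val.
have mu_inf A : mu A = ereal_inf [set mu U | U in [set U : set K | open U /\ A `<=` U]].
  rewrite /mu/= /outer; congr ereal_inf; apply: eq_imagel => U [oU _].
  by rewrite -/(outer U) outer_open.
move=> A mA; split; last exact: mu_inf.
apply/eqP; rewrite eq_le; apply/andP; split; last first.
  apply: ge_ereal_sup => _ [C [cC CA] <-]; exact: le_outer.
apply/lee_addgt0Pr => e e0.
(* Inner regularity of [A] is outer regularity of its complement: the complement of [U] is a compact
   subset of [A]. *)
have [U [oU AU Ue]] := outer_adherent (~` A) e0.
have UA : ~` U `<=` A by rewrite -[A]setCK; exact: subsetC.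
have mUb : measurable (U : set (borel K)) by exact: sub_gen_smallest.
have muA : outer A = 1 - outer (~` A).
  by rewrite -[in LHS](setCK A); apply: (probability_setC mu); exact: measurableC.
have muU : outer (~` U) = 1 - outer U by exact: (probability_setC mu).
apply: (@le_trans _ _ (outer (~` U) + e%:E)).
  rewrite -outer_open// in Ue; rewrite -[leLHS]/(outer A) muA muU.
  have := outer_fin U; have := outer_fin (~` A).
  case: (outer U) Ue => // u; case: (outer (~` A)) => //= a ua _ _.
  by move: ua; rewrite -!EFinD !lee_fin => ua; lra.
rewrite leeD2r//; apply: ereal_sup_ubound; exists (~` U) => //; split => //.
apply: (subclosed_compact _ K_compact) => //; exact: open_closedC.
Qed.

End charge_regularization.

(** * The variation of a functional on bounded functions *)

Fact linf_restrict_subproof {R : realType} (S : Type) (A : set S) (v : linf R S) :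
  (fun s => if `[< A s >] then v s else 0) \in @linf_pred R S.
Proof.
rewrite inE; apply/linf_setP; exists `|v| => s.
by case: asboolP => _; [exact: linf_le_norm|rewrite normr0].
Qed.

Definition linf_restrict {R : realType} (S : Type) (A : set S) (v : linf R S) :=
  Linf (linf_restrict_subproof A v).

Lemma linf_restrictDC {R : realType} (S : Type) (A : set S) (v : linf R S) :
  v = linf_restrict A v + linf_restrict (~` A) v.
Proof.
apply: linfE => s; 
rewrite -[RHS]/((if `[< A s >] then v s else 0) + (if `[< ~ A s >] then v s else 0)).
rewrite asbool_neg.
by case: asboolP => _ /=; rewrite ?addr0 ?add0r.
Qed.

Section variation.
Context {R : realType} (S K : Type) (p : S -> K) (Psi : dual (linf R S)).

Definition dominated (A : set K) : set (linf R S) :=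
  [set v | forall s, `|v s| <= (`[< A (p s) >])%:R].

(** This is the image under [p] of the total variation of the finitely additive signed measure that
    represents [Psi]. *)
Definition variation (A : set K) : R := sup [set Psi v | v in dominated A].

Let dominated_norm A v : dominated A v -> `|v| <= 1.
Proof.
move=> Av; apply: linf_norm_le => // s.
by rewrite (le_trans (Av s))//; case: asboolP.
Qed.

Let variation_has_sup A : has_sup [set Psi v | v in dominated A].
Proof.
split; first by exists (Psi 0), 0 => // s /=; rewrite normr0.
exists `|Psi| => _ [v Av <-].
rewrite (le_trans (ler_norm _))// (le_trans (dual_le_norm _ _))//.
by rewrite ler_piMr ?(dominated_norm Av)//; exact: dual_norm_ge0.
Qed.

Lemma variation_ge A v : dominated A v -> Psi v <= variation A.
Proof. by move=> Av; apply: ub_le_sup; [case: (variation_has_sup A)|exists v]. Qed.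

Lemma variation_ge0 A : 0 <= variation A.
Proof. by rewrite -(linear0 Psi); apply: variation_ge => s /=; rewrite normr0. Qed.

(** A function dominated over the union splits into its restrictions over [A] and over the
    complement of [A]. Conversely, functions living over disjoint sets add up without exceeding
    1. *)
Lemma variationU A B : A `&` B = set0 ->
  variation (A `|` B) = variation A + variation B.
Proof.
move=> AB0; have nAB s : A s -> B s -> False.
  by move=> As Bs; have : (A `&` B) s by []; rewrite AB0.
apply/eqP; rewrite eq_le; apply/andP; split.
  apply: ge_sup; first by case: (variation_has_sup (A `|` B)).
  move=> _ [v ABv <-]; rewrite (linf_restrictDC (p @^-1` A) v) linearD lerD//.
    apply: variation_ge => s /=; rewrite -[`[< (p @^-1` A) s >]]/`[< A (p s) >].
    case: asboolP => [As|_]; last by rewrite normr0.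
    by rewrite (le_trans (ABv s))//; case: asboolP.
  apply: variation_ge => s /=; case: asboolP => [nAs|_]; last by rewrite normr0.
  have := ABv s; case: (asboolP ((A `|` B) (p s))) => [[]//|_] vs.
    by case: asboolP.
  by rewrite (le_trans vs).
have key v w : dominated A v -> dominated B w ->
    Psi v + Psi w <= variation (A `|` B).
  move=> Av Bw; rewrite -linearD; apply: variation_ge => s /=.
  rewrite (le_trans (ler_normD _ _))//.
  have := Av s; have := Bw s.
  case: asboolP => Bs; case: asboolP => As; case: asboolP => ABs; rewrite /=.
  - by have := nAB _ As Bs.
  - by have := nAB _ As Bs.
  - by lra.
  - by case: ABs; right.
  - by lra.
  - by case: ABs; left.
  - by lra.
  - by lra.
rewrite -lerBrDr; apply: ge_sup; first by case: (variation_has_sup A).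
move=> _ [v Av <-]; rewrite lerBrDr addrC -lerBrDr.
apply: ge_sup; first by case: (variation_has_sup B).
by move=> _ [w Bw <-]; rewrite lerBrDr addrC; exact: key.
Qed.

Lemma variation_eq0 A (v : linf R S) : variation A = 0 ->
  (forall s, ~ A (p s) -> v s = 0) -> Psi v = 0.
Proof.
move=> A0 vA; have n0 : 0 < `|v| + 1 by rewrite ltr_wpDl.
(* The choices [e = 1] and [e = -1] bound [Psi v] from above and from below; adding 1 to the norm
   avoids dividing by zero. *)
have dv (e : R) : `|e| <= 1 -> dominated A ((e / (`|v| + 1)) *: v).
  move=> e1 s /=; rewrite -[(_ *: _) s]/(e / (`|v| + 1) * v s).
  case: asboolP => [As|/vA ->]; last by rewrite mulr0 normr0.
  rewrite normrM normrM normfV (gtr0_norm n0) -mulrA.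
  apply: mulr_ile1 => //.
  rewrite mulrC ler_pdivrMr// mul1r (le_trans (linf_le_norm v s))//.
  by rewrite lerDl.
have := variation_ge (dv (-1) _); have := variation_ge (dv 1 _).
rewrite !linearZ/= A0 normrN normr1 => /(_ (lexx _)) h1 /(_ (lexx _)) h2.
have i0 : 0 < 1 / (`|v| + 1) by rewrite divr_gt0.
apply/eqP; rewrite eq_le; apply/andP; split.
  by rewrite -(pmulr_rle0 _ i0).
by rewrite -(pmulr_rge0 _ i0) -oppr_le0 -mulNr -mulNr.
Qed.

End variation.

(** * Functionals controlled by the support of a regular probability *)

Lemma null_open_cover {R : realType} (K : ptopologicalType)
    (mu : {measure set (borel K) -> \bar R}) (C : set K) :
  compact C -> (forall k, C k -> ~ measure_support mu k) ->
  exists U : set K, [/\ open U, C `<=` U & mu U = 0%E].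
Proof.
move=> cC nC.
have [U UP] : {U : K -> set K & forall k, [/\ open (U k), mu (U k) = 0%E &
    C k -> U k k]}.
  apply: (@choice _ _ (fun k U => [/\ open U, mu U = 0%E & C k -> U k])) => k.
  have [Ck|nCk] := pselect (C k); last first.
    by exists set0; split; [exact: open0|exact: measure0|].
  have /existsNP[V /not_implyP[oV /not_implyP[Vk nV]]] := nC k Ck.
  exists V; split => //; apply/eqP; rewrite eq_le measure_ge0 andbT leNgt.
  exact/negP.
move: cC; rewrite compact_cover => /(_ K setT U) [k _|k Ck|D _ CD].
- by have [] := UP k.
- by exists k => //; have [_ _] := UP k; apply.
have seqP (l : seq K) : open (\big[setU/set0]_(k <- l) U k) /\
    mu (\big[setU/set0]_(k <- l) U k) = 0%E.
  elim: l => [|k l [ol ml]].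
    by rewrite big_nil; split; [exact: open0|rewrite measure0].
  have [ok mk _] := UP k.
  rewrite big_cons; split; first exact: openU.
  apply/eqP; rewrite eq_le measure_ge0 andbT.
  have : (mu (U k) + mu (\big[setU/set0]_(k <- l) U k) <= 0)%E.
    by rewrite ml mk adde0.
  by apply: le_trans; apply: measureU2; exact: sub_gen_smallest.
exists (\big[setU/set0]_(k <- finmap.enum_fset D) U k); split.
- exact: (seqP _).1.
- by move=> k /CD[i /= iD Uik]; rewrite -bigcup_seq; exists i.
- exact: (seqP _).2.
Qed.

(** The set [C] where [|h| >= e] is compact and misses the support, so it lies in a null open set
    and has variation 0. The part of [v] over [C] is thus killed by [Psi], the other part has norm
    at most [e], and [e] is arbitrary. *)
Lemma regular_probability_dominating {R : realType} (S : Type)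
    (K : ptopologicalType) (p : S -> K) (Psi : dual (linf R S)) :
  hausdorff_space K -> compact [set: K] ->
  exists2 mu : probability (borel K) R, regular_measure mu &
    forall h : K -> R, continuous h ->
      (forall k, measure_support mu k -> h k = 0) ->
      forall v : linf R S, (forall s, `|v s| <= `|h (p s)|) -> Psi v = 0.
Proof.
move=> hK cK.
(* The Dirac mass keeps the normalisation meaningful when [Psi = 0]. *)
pose m A := (variation p Psi A + (`[< A point >])%:R) / (variation p Psi setT + 1).
have d0 : 0 < variation p Psi setT + 1 by rewrite ltr_wpDl// variation_ge0.
have m_ge0 A : 0 <= m A.
  by rewrite divr_ge0 ?(ltW d0)// addr_ge0// variation_ge0.
have mU A B : A `&` B = set0 -> m (A `|` B) = m A + m B.
  move=> AB; rewrite /m -mulrDl variationU// addrACA; congr ((_ + _ + _) / _).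
  case: asboolP => ABs; case: asboolP => As; case: asboolP => Bs;
    rewrite /= ?addr0 ?add0r//.
  - by have : (A `&` B) point by []; rewrite AB.
  - by case: ABs.
  - by case: ABs; left.
  - by case: ABs; left.
  - by case: ABs; right.
have m1 : m setT = 1.
  by rewrite /m (_ : `[< setT point >] = true) ?divff ?gt_eqF//; exact/asboolP.
have [mu mu_reg mu_m] := regular_probability_of_additive hK cK m_ge0 mU m1.
exists mu => // h ch h0 v vh.
suff le e : 0 < e -> `|Psi v| <= `|Psi| * e.
  apply/eqP; rewrite -normr_le0; apply/ler_addgt0Pl => e e0; rewrite addr0.
  have P1 : 0 < `|Psi| + 1 by rewrite ltr_wpDl.
  rewrite (le_trans (le _ (divr_gt0 e0 P1)))// mulrCA ler_piMr ?(ltW e0)//.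
  by rewrite ler_pdivrMr// mul1r lerDl.
move=> e0; pose C := [set k | e <= `|h k|].
have cC : closed C.
  rewrite (_ : C = (fun k => `|h k|) @^-1` [set r | e <= r])//.
  apply: preimage_closed; last exact: closed_ge.
  move=> k _; apply: (@continuous_comp _ _ _ h (fun r : R => `|r|)); first exact: ch.
  exact: (@norm_continuous R R^o).
have [||V [oV CV muV]] := @null_open_cover R K mu C.
- exact: (subclosed_compact cC cK).
- by move=> k Ck /h0 hk; move: Ck; rewrite /C/= hk normr0 leNgt e0.
have mC : m C = 0.
  apply/eqP; rewrite eq_le m_ge0 andbT -lee_fin.
  by rewrite (le_trans (mu_m _ _ cC oV CV))// muV.
have vC : variation p Psi C = 0.
  move/eqP: mC; rewrite mulf_eq0 invr_eq0 (gt_eqF d0) orbF paddr_eq0 ?variation_ge0//.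
  by move=> /andP[/eqP].
rewrite (linf_restrictDC (p @^-1` C) v) linearD/=.
rewrite (variation_eq0 vC) ?add0r; last first.
  by move=> s nCs /=; case: asboolP.
rewrite (le_trans (dual_le_norm _ _))// ler_wpM2l ?dual_norm_ge0//.
apply: linf_norm_le; first exact: ltW.
move=> s /=; case: asboolP => [nC|_]; last by rewrite normr0 ltW.
by rewrite (le_trans (vh s))// ltW// ltNge; exact/negP.
Qed.

(** * WLD injective tensor products *)

Fact etensor_subproof {R : realType} (X Y : normedModType R) (x : X) (y : Y) :
  tensor x y \in @itensor_pred R X Y.
Proof.
rewrite inE; apply: subset_closure; exists 1%N, (fun=> x), (fun=> y).
by rewrite big_ord1.
Qed.

Definition etensor {R : realType} (X Y : normedModType R) (x : X) (y : Y) :=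
  Itensor (etensor_subproof x y).

Section etensor.
Context {R : realType} {X Y : normedModType R}.

Lemma etensor_linearl (y : Y) : linear (fun x : X => etensor x y).
Proof. by move=> a u v; apply: val_inj; rewrite /= tensorDl tensorZl. Qed.

Lemma etensor_linearr (x : X) : linear (fun y : Y => etensor x y).
Proof. by move=> a u v; apply: val_inj; rewrite /= tensorDr tensorZr. Qed.

Lemma etensor_norm (x : X) (y : Y) : `|etensor x y| <= `|x| * `|y|.
Proof.
rewrite itensor_normE; apply: linf_norm_le => [|p]; first exact: mulr_ge0.
by rewrite normrM ler_pM// dual_ball_le.
Qed.

Lemma itensor_valB_sum (u : itensor X Y) n (x : 'I_n -> X) (y : 'I_n -> Y) :
  itensor_val (u - \sum_(i < n) etensor (x i) (y i)) =
  itensor_val u - \sum_(i < n) tensor (x i) (y i).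
Proof. by rewrite -[itensor_val _]/(val _) raddfB raddf_sum. Qed.

Lemma itensor_approx (u : itensor X Y) (e : R) : 0 < e ->
  exists (n : nat) (x : 'I_n -> X) (y : 'I_n -> Y),
    `|u - \sum_(i < n) etensor (x i) (y i)| < e.
Proof.
move=> e0; have /itensor_predP/(_ e e0)[_ [n [x [y ->]]] ue] := itensor_valP u.
exists n, x, y; rewrite itensor_normE; by rewrite itensor_valB_sum.
Qed.

Lemma itensor_dual_eq0 (f : dual (itensor X Y)) :
  (forall x y, f (etensor x y) = 0) -> f = 0.
Proof.
move=> f0; apply: dualE => u; apply/eqP; rewrite -normr_le0.
apply/ler_addgt0Pl => e e0; rewrite addr0.
have P1 : 0 < `|f| + 1 by rewrite ltr_wpDl.
have [n [x [y uxy]]] := itensor_approx u (divr_gt0 e0 P1).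
have -> : f u = f (u - \sum_(i < n) etensor (x i) (y i)).
  by rewrite linearB linear_sum/= big1 ?subr0 // => i _; exact: f0.
rewrite (le_trans (dual_le_norm _ _))//.
rewrite (le_trans (ler_wpM2l (dual_norm_ge0 f) (ltW uxy)))//.
by rewrite mulrCA ler_piMr ?(ltW e0)// ler_pdivrMr// mul1r lerDl.
Qed.

End etensor.

(** One factor at a time: with [x i] fixed, [f] is a functional on [Y] that vanishes on the family
    [y]; then, with any [v] fixed, a functional on [X] that vanishes on the family [x]. *)
Lemma itensor_total {R : realType} (X Y : normedModType R) (I J : Type)
    (x : I -> X) (y : J -> Y) :
  (forall f : dual X, (forall i, f (x i) = 0) -> f = 0) ->
  (forall f : dual Y, (forall j, f (y j) = 0) -> f = 0) ->
  forall f : dual (itensor X Y), (forall i j, f (etensor (x i) (y j)) = 0) -> f = 0.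
Proof.
move=> xtot ytot f fxy; apply: itensor_dual_eq0.
have fx i v : f (etensor (x i) v) = 0.
  have [|||g gE _] := @dual_of_bounded R Y (fun v => f (etensor (x i) v)) (`|f| * `|x i|).
  - by move=> a u w; rewrite etensor_linearr linearP.
  - by rewrite mulr_ge0.
  - move=> w; rewrite (le_trans (dual_le_norm _ _))// -mulrA.
    by rewrite ler_wpM2l ?dual_norm_ge0// etensor_norm.
  - by rewrite -[LHS]/((fun v => f (etensor (x i) v)) v) -gE (ytot g)// => j; rewrite gE.
move=> u v.
have [|||g gE _] := @dual_of_bounded R X (fun u => f (etensor u v)) (`|f| * `|v|).
- by move=> a w z; rewrite etensor_linearl linearP.
- by rewrite mulr_ge0.
- move=> w; rewrite (le_trans (dual_le_norm _ _))// -mulrA.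
  by rewrite ler_wpM2l ?dual_norm_ge0// mulrC etensor_norm.
- by rewrite -[LHS]/((fun u => f (etensor u v)) u) -gE (xtot g)// => i; rewrite gE.
Qed.

(** Take a countable dense subset of the support of the dominating probability. Each of its points
    is nonzero at countably many [x i]; every other [x i] vanishes on the whole support by
    continuity. *)
Lemma countable_undominated {R : realType} (X : normedModType R) (S I : Type)
    (p : S -> dual_ball X) (Psi : dual (linf R S)) (x : I -> X) :
  property_M R (dual_ball X) ->
  (forall f : dual X, countable [set i | f (x i) != 0]) ->
  exists2 D : set I, countable D & forall i, ~ D i ->
    forall (c : R) (v : linf R S),
      (forall s, `|v s| <= c * `|dual_ball_fun (p s) (x i)|) -> Psi v = 0.
Proof.
move=> XM xc.
have [mu mu_reg muP] := regular_probability_dominating p Psi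
  (@dual_ball_hausdorff R X) (@banach_alaoglu R X).
have [D [cD DS SD]] := XM mu mu_reg.
exists (\bigcup_(f in D) [set i | dual_ball_fun f (x i) != 0]).
  by apply: bigcup_countable => // f _; exact: xc.
move=> i nDi c v vx.
have Dx f : D f -> dual_ball_fun f (x i) = 0.
  by move=> Df; apply/eqP/negPn/negP => fx; apply: nDi; exists f.
apply: (muP (fun f => dual_ball_fun f (c *: x i))) => [|g /SD gD|s].
- exact: dual_ball_eval_continuous.
- have cK : closed [set f : dual_ball X | dual_ball_fun f (c *: x i) = 0].
    rewrite (_ : [set _ | _] = (fun f => dual_ball_fun f (c *: x i)) @^-1` [set r : R | r = 0])//.
    apply: preimage_closed; last exact: closed_eq.
    by move=> h _; exact: dual_ball_eval_continuous.
  apply: cK; move: gD; apply: closure_subset => h /Dx hx /=.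
  by rewrite linearZ/= hx scaler0.
- rewrite (le_trans (vx s))// linearZ/= normrM ler_wpM2r//; exact: ler_norm.
Qed.

Lemma wld_itensor {R : realType} (X Y : normedModType R) :
  wld X -> property_M R (dual_ball X) -> wld Y -> property_M R (dual_ball Y) ->
  wld (itensor X Y).
Proof.
move=> /wldP[I [x [[i0] xc xtot]]] XM /wldP[J [y [[j0] yc ytot]]] YM.
apply/wldP; exists (I * J)%type, (fun g => etensor (x g.1) (y g.2)); split.
- exact: (inhabits (i0, j0)).
- move=> f.
  have [Psi _ fE] := dual_extension f
    (fun a u v => erefl : itensor_val (a *: u + v) = a *: itensor_val u + itensor_val v)
    (fun u => erefl).
  have [D1 cD1 D1P] := countable_undominated fst Psi XM xc.
  have [D2 cD2 D2P] := countable_undominated snd Psi YM yc.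
  apply: (@sub_countable _ _ _ (D1 `*` D2)); last exact: countableX.
  apply: subset_card_le => -[i j] /= fij.
  have {}fij : Psi (tensor (x i) (y j)) <> 0.
    by apply/eqP; move: fij; rewrite -fE.
  (* On the product of the balls, the tensor of [x i] and [y j] is bounded by [|y j|] times the
     modulus of [x i], and by [|x i|] times that of [y j]. *)
  split; apply: contrapT => /=.
    move=> /D1P/(_ `|y j| (tensor (x i) (y j)))-/(_ _)/fij; apply => s /=.
    by rewrite normrM mulrC ler_wpM2r// dual_ball_le.
  move=> /D2P/(_ `|x i| (tensor (x i) (y j)))-/(_ _)/fij; apply => s /=.
  by rewrite normrM ler_wpM2r// dual_ball_le.
- by move=> f f0; apply: (itensor_total xtot ytot) => i j; exact: (f0 (i, j)).
Qed.

(** * Slices of tensors *)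

Lemma dual_ball_norming {R : realType} (X : normedModType R) (x : X) :
  exists f : dual_ball X, dual_ball_fun f x = `|x|.
Proof. by have [f f1 fx] := dual_norming x; exists (exist _ f f1). Qed.

Lemma dual_ball_separates {R : realType} (X : normedModType R) (x y : X) :
  (forall f : dual_ball X, dual_ball_fun f x = dual_ball_fun f y) -> x = y.
Proof.
move=> xy; have [f fxy] := dual_ball_norming (x - y).
by apply/eqP; rewrite -subr_eq0 -normr_eq0 -fxy linearB/= xy subrr.
Qed.

(** For a finite sum of elementary tensors the slice is the sum of the [g (y i) *: x i].
    Approximating [u] by such sums gives a Cauchy filter, since the dual ball is norming, and [X] is
    complete. *)
Lemma itensor_slice {R : realType} (X : completeNormedModType R)
    (Y : normedModType R) (g : dual_ball Y) (u : itensor X Y) :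
  exists x : X, forall f : dual_ball X, dual_ball_fun f x = itensor_val u (f, g).
Proof.
pose B (e : R) := [set x : X | forall f : dual_ball X,
  `|dual_ball_fun f x - itensor_val u (f, g)| <= e].
pose F : set_system X := filter_from [set e : R | 0 < e] B.
have FF : ProperFilter F.
  apply: filter_from_proper; last first.
    move=> e /= e0; have [n [x [y uxy]]] := itensor_approx u e0.
    exists (\sum_(i < n) dual_ball_fun g (y i) *: x i) => f.
    rewrite distrC; apply: le_trans (ltW uxy).
    rewrite itensor_normE itensor_valB_sum.
    apply: le_trans (linf_le_norm _ (f, g)).
    rewrite -[X in _ <= `|X|]/(itensor_val u (f, g) - (\sum_(i < n) tensor (x i) (y i)) (f, g)).
    rewrite linear_sum/= le_eqVlt; apply/orP; left; apply/eqP; congr `|_ - _|.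
    rewrite -[RHS]/(linf_fun (\sum_(i < n) tensor (x i) (y i)) (f, g)).
    elim/big_rec2 : _ => // i a b _ ->.
    rewrite linearZ/= -[RHS]/(dual_ball_fun f (x i) * dual_ball_fun g (y i) +
      linf_fun a (f, g)).
    by rewrite mulrC.
  apply: filter_from_filter; first by exists 1; exact: ltr01.
  move=> e d /= e0 d0; exists (Num.min e d); first by rewrite /= lt_min e0.
  by move=> x Bx; split=> f; rewrite (le_trans (Bx f))// ge_min lexx ?orbT.
have /cvg_ex[l Fl] : cvg F.
  apply: cauchy_cvg; apply/cauchy_ballP => e e0.
  have e4 : 0 < e / 4 by rewrite divr_gt0.
  exists (B (e / 4), B (e / 4)); first by split; exists (e / 4).
  move=> [x y] [/= Bx By]; rewrite -ball_normE/=.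
  have [f <-] := dual_ball_norming (x - y); rewrite linearB.
  have := Bx f; have := By f; rewrite !ler_norml => /andP[? ?] /andP[? ?].
  rewrite -[_ - _]/(dual_ball_fun f x - dual_ball_fun f y); lra.
exists l => f; apply/eqP; rewrite -subr_eq0 -normr_le0.
apply/ler_addgt0Pl => e e0; rewrite addr0.
apply: (@closed_cvg _ _ F _ (fun x => dual_ball_fun f x)
  (fun r => `|r - itensor_val u (f, g)| <= e)).
- rewrite (_ : (fun r => _) = closed_ball_ Num.norm (itensor_val u (f, g)) e).
    exact: closed_closed_ball_.
  by apply/funext => r; rewrite /closed_ball_ /= distrC.
- by exists e => // x; exact.
- by apply: cvg_comp Fl _; exact: dual_continuous.
Qed.

(** Slicing by a [g] that norms [e] is a contraction onto [X], as it sends the tensor of [x] and [e]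
    to [|e| *: x]. The slices of the family [u] inherit both properties by composing functionals
    with the slice map. *)
Lemma wld_of_itensor {R : realType} (X : completeNormedModType R)
    (Y : normedModType R) (e : Y) : e != 0 -> wld (itensor X Y) -> wld X.
Proof.
move=> e0 /wldP[Gamma [u [inh uc utot]]].
have [g ge] := dual_ball_norming e.
pose sl (v : itensor X Y) : X := projT1 (cid (itensor_slice g v)).
have slP v (f : dual_ball X) : dual_ball_fun f (sl v) = itensor_val v (f, g).
  by rewrite /sl; case: cid.
have sl_lin : linear sl.
  move=> a v w; apply: dual_ball_separates => f.
  by rewrite linearP/= !slP.
have sl_norm v : `|sl v| <= `|v|.
  have [f <-] := dual_ball_norming (sl v); rewrite slP itensor_normE.
  exact: le_trans (ler_norm _) (linf_le_norm _ _).
have lift (f : dual X) : exists F : dual (itensor X Y), forall v, F v = f (sl v).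
  have [|||F FE _] := @dual_of_bounded R (itensor X Y) (fun v => f (sl v)) `|f|.
  - by move=> a v w; rewrite sl_lin linearP.
  - by [].
  - move=> v; rewrite (le_trans (dual_le_norm _ _))//.
    by rewrite ler_wpM2l// dual_norm_ge0.
  - by exists F => v; rewrite FE.
apply/wldP; exists Gamma, (fun i => sl (u i)); split => //.
- move=> f; have [F FE] := lift f; apply: sub_countable (uc F).
  by apply: subset_card_le => i /=; rewrite FE.
- move=> f f0; have [F FE] := lift f.
  have F0 : F = 0 by apply: utot => i; rewrite FE f0.
  apply: dualE => x.
  have sle : sl (etensor x e) = `|e| *: x.
    apply: dual_ball_separates => h; rewrite slP linearZ/= -ge.
    exact: mulrC.
  have := FE (etensor x e); rewrite F0 sle linearZ/= => /esym/eqP.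
  by rewrite mulf_eq0 normr_eq0 (negbTE e0) => /eqP.
Qed.

(** Covers the zero space, where no nonzero vector is available for slicing. *)
Lemma wld_trivial {R : realType} (X : normedModType R) :
  (forall x : X, x = 0) -> wld X.
Proof.
move=> X0; have f0 (f : dual X) : f = 0.
  by apply: dualE => x; rewrite (X0 x) linear0.
apply/wldP; exists unit, (fun=> 0); split => //.
Qed.

(** * Countable tightness and separability *)

Lemma countable_enum (I : Type) (T : Type) (t0 : T) (x : I -> T) (A : set I) :
  countable A -> exists e : nat -> T, forall i, A i -> exists n, e n = x i.
Proof.
move=> cA; have /pcard_injP[f fI] := cA.
(* The default [t0] fills the indices outside the range of [f], so an empty [A] needs no separate
   case. *)
pose e n := if pselect (exists2 i, A i & f i = n) is left P
  then x (projT1 (cid2 P)) else t0.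
exists e => i Ai; exists (f i); rewrite /e; case: pselect => [P|[]]; last by exists i.
by case: cid2 => j /= Aj fj; congr x; apply: fI => //; rewrite inE.
Qed.

(* Every selected functional is close to [phi] on the first elements of the
   supports of [phi] and of the functionals selected before, so on the total
   family [z] the selection converges to [phi]. *)
Lemma countable_support_approx {R : realType} (Z : normedModType R) (I J : Type)
    (z : I -> Z) (w : J -> Z) (phi : dual_ball Z) :
  (forall f : dual Z, countable [set i | f (z i) != 0]) ->
  (forall f : dual Z, (forall i, f (z i) = 0) -> f = 0) ->
  (forall (us : seq Z) (e : R), 0 < e -> exists psi : dual_ball Z,
    countable [set j | dual_ball_fun psi (w j) != 0] /\
    forall u, u \in us -> `|dual_ball_fun phi u - dual_ball_fun psi u| <= e) ->
  countable [set j | dual_ball_fun phi (w j) != 0].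
Proof.
move=> zc ztot approx.
have [e eP] : {e : dual_ball Z -> nat -> Z & forall f i,
    dual_ball_fun f (z i) != 0 -> exists n, e f n = z i}.
  apply: (@choice _ _ (fun f e => forall i, dual_ball_fun f (z i) != 0 ->
    exists n, e n = z i)) => f.
  exact: (countable_enum 0 z (zc (dual_ball_fun f))).
pose good (p : nat * seq (dual_ball Z)) (psi : dual_ball Z) :=
  countable [set j | dual_ball_fun psi (w j) != 0] /\
  forall f k, f \in phi :: p.2 -> (k <= p.1)%N ->
    `|dual_ball_fun phi (e f k) - dual_ball_fun psi (e f k)| <= p.1.+1%:R^-1.
have [step stepP] : {step : nat * seq (dual_ball Z) -> dual_ball Z &
    forall p, good p (step p)}.
  apply: (@choice _ _ good) => -[n h].
  have n0 : 0 < n.+1%:R^-1 :> R by rewrite invr_gt0.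
  have [psi [psic psiP]] :=
    approx [seq e f k | f <- phi :: h, k <- iota 0 n.+1] _ n0.
  exists psi; split => // f k fh kn; apply: psiP.
  by apply/allpairsP; exists (f, k); rewrite mem_iota add0n ltnS.
pose hist := fix hist n := if n is n'.+1 then step (n', hist n') :: hist n' else [::].
pose t n := step (n, hist n).
have t_hist m n : (m < n)%N -> t m \in hist n.
  elim: n => // n ih; rewrite ltnS leq_eqVlt => /orP[/eqP->|/ih mn].
    by rewrite /= inE eqxx.
  by rewrite /= inE mn orbT.
have t_cvg f k N : (forall n, (N <= n)%N -> f \in phi :: hist n) ->
    (fun n => dual_ball_fun (t n) (e f k)) @ \oo --> dual_ball_fun phi (e f k).
  move=> fN; apply/cvgrPdist_lt => d d0.
  have small := near_infty_natSinv_lt (PosNum d0).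
  near=> n; have [_ tn] := stepP (n, hist n).
  apply: le_lt_trans (tn f k _ _) _ => /=.
  - by apply: fN; near: n; exact: nbhs_infty_ge.
  - by near: n; exact: nbhs_infty_ge.
  - by near: n.
have phi_cl : cluster (t @ \oo) phi.
  apply: (dual_ball_cluster ztot) => i.
  (* If [phi] or some [t m] is nonzero at [z i], then [z i] is enumerated and controlled from some
     stage on. Otherwise [phi] and all the [t n] vanish there. *)
  have [phi0|phi0] := eqVneq (dual_ball_fun phi (z i)) 0; last first.
    have [k <-] := eP _ _ phi0.
    by apply: (t_cvg phi k 0%N) => n _; rewrite mem_head.
  have [[m tm]|t0] := pselect (exists m, dual_ball_fun (t m) (z i) != 0).
    have [k <-] := eP _ _ tm.
    by apply: (t_cvg (t m) k m.+1) => n mn; rewrite inE t_hist ?orbT.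
  rewrite (_ : (fun n => _) = fun=> dual_ball_fun phi (z i)); first exact: cvg_cst.
  apply/funext => n; rewrite phi0; apply/eqP/negPn/negP => tn.
  by apply: t0; exists n.
(* The cluster point [phi] vanishes at [w j] whenever all the [t n] do. *)
apply: (@sub_countable _ _ _ (\bigcup_n [set j | dual_ball_fun (t n) (w j) != 0])).
  apply: subset_card_le => j /= phij; apply: contrapT => nj.
  have tj n : dual_ball_fun (t n) (w j) = 0.
    by apply/eqP/negPn/negP => tn; apply: nj; exists n.
  have d0 : 0 < `|dual_ball_fun phi (w j)| by rewrite normr_gt0.
  have /cvgrPdist_lt/(_ _ d0) cphi := @dual_ball_eval_continuous R Z (w j) phi.
  have [|h [/= -> ]] := phi_cl [set h | dual_ball_fun h (w j) = 0] _ _ cphi.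
    by exists 0%N => // n _ /=.
  by rewrite subr0 ltxx.
by apply: bigcup_countable => // n _; have [] := stepP (n, hist n).
Unshelve. all: by end_near. Qed.

(** Only countably many coordinates are nonzero on [S]. For each finite list of rationals that
    approximates the first of these coordinates at some point of [S], one such point is picked; the
    other coordinates agree trivially. *)
Lemma dual_ball_separable {R : realType} (X : normedModType R) (I : Type)
    (x : I -> X) (S : set (dual_ball X)) :
  (forall f : dual X, (forall i, f (x i) = 0) -> f = 0) ->
  countable [set i | exists2 f, S f & dual_ball_fun f (x i) != 0] ->
  separable_set S.
Proof.
move=> xtot cT; have [e eP] := countable_enum 0 x cT.
pose near_code (p : nat * seq rat) (t : dual_ball X) := S t /\ forall i,
  (i < p.1)%N -> `|ratr (nth 0 p.2 i) - dual_ball_fun t (e i)| <= p.1.+1%:R^-1.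
pose pick p := xget point (near_code p).
pose D := pick @` [set p | exists t, near_code p t].
have pickP p t : near_code p t -> near_code p (pick p).
  by move=> pt; apply: xgetPex; exists t.
exists D; split.
- by apply: sub_countable (card_image_le _ _) _; exact: countableP.
- by move=> _ [p [t pt] <-]; have [] := pickP p t pt.
move=> s Ss.
have code n : exists q : seq rat, near_code (n, q) s.
  have n0 : 0 < n.+1%:R^-1 :> R by rewrite invr_gt0.
  have [q qP] : {q : nat -> rat & forall i,
      `|ratr (q i) - dual_ball_fun s (e i)| <= n.+1%:R^-1}.
    apply: (@choice _ _ (fun i q => `|ratr q - dual_ball_fun s (e i)| <= n.+1%:R^-1)) => i.
    have lt_s : dual_ball_fun s (e i) < dual_ball_fun s (e i) + n.+1%:R^-1.
      by rewrite ltrDl.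
    have [q] := rat_in_itvoo lt_s; rewrite in_itv/= => /andP[q1 q2]; exists q.
    by rewrite ger0_norm ?subr_ge0 ?(ltW q1)// lerBlDl ltW.
  by exists (mkseq q n); split => // i /= ni; rewrite nth_mkseq.
have [q qP] := choice code.
pose t n := pick (n, q n).
have tP n : near_code (n, q n) (t n) by exact: pickP (qP n).
have tD n : D (t n) by exists (n, q n) => //; exists s.
have s_cl : cluster (t @ \oo) s.
  apply: (dual_ball_cluster xtot) => i.
  have [Ti|nTi] := pselect (exists2 f, S f & dual_ball_fun f (x i) != 0); last first.
    have f0 f : S f -> dual_ball_fun f (x i) = 0.
      by move=> Sf; apply/eqP/negPn/negP => fi; apply: nTi; exists f.
    rewrite (_ : (fun n => _) = fun=> dual_ball_fun s (x i)); first exact: cvg_cst.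
    by apply/funext => n; rewrite !f0//; have [] := tP n.
  have [k <-] := eP i Ti.
  apply/cvgrPdist_lt => d d0.
  have d2 : 0 < d / 2 by rewrite divr_gt0.
  have small := near_infty_natSinv_lt (PosNum d2).
  near=> n.
  have kn : (k < n)%N by near: n; exact: nbhs_infty_gt.
  have : n.+1%:R^-1 < d / 2 by near: n.
  have [_ /(_ k kn)] := tP n; have [_ /(_ k kn)] := qP n.
  rewrite /=; move: (n.+1%:R^-1 : R) => c.
  rewrite !ler_norml => /andP[? ?] /andP[? ?] ?.
  by rewrite ltr_norml; apply/andP; split; lra.
by move=> U; apply: s_cl; exists 0%N => // n _; exact: tD.
Unshelve. all: by end_near. Qed.

(** * Integration along the diagonal *)

Lemma continuous_borel_measurable {R : realType} (K : ptopologicalType)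
    (h : K -> R) : continuous h -> measurable_fun [set: borel K] (h : borel K -> R).
Proof.
move=> ch; apply: (measurability _ (RGenOInfty.measurableE R)) => _ [_ [r ->] <-].
rewrite setTI; apply: sub_gen_smallest; rewrite set_itvE.
by apply: open_comp; [move=> *; exact: ch|exact: open_gt].
Qed.

(** A uniform limit of finite sums of products of two evaluations. *)
Lemma itensor_diag_continuous {R : realType} (X : normedModType R)
    (u : itensor X X) :
  continuous (fun f : dual_ball X => itensor_val u (f, f)).
Proof.
move=> f; apply/(@cvgrPdist_lt _ R^o _ (nbhs f)) => e e0.
have e3 : 0 < e / 3 by rewrite divr_gt0.
have [n [x [y uxy]]] := itensor_approx u e3.
pose w (h : dual_ball X) := \sum_(i < n) dual_ball_fun h (x i) * dual_ball_fun h (y i).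
have uw h : `|itensor_val u (h, h) - w h| < e / 3.
  apply: le_lt_trans uxy; rewrite itensor_normE itensor_valB_sum.
  apply: le_trans (linf_le_norm _ (h, h)).
  rewrite -[X in _ <= `|X|]/(itensor_val u (h, h) - (\sum_(i < n) tensor (x i) (y i)) (h, h)).
  rewrite le_eqVlt; apply/orP; left; apply/eqP; congr `|_ - _|; rewrite /w.
  rewrite -[RHS]/(linf_fun (\sum_(i < n) tensor (x i) (y i)) (h, h)).
  by elim/big_rec2 : _ => // i a b _ ->.
have cw : continuous w.
  apply: continuous_big => [|i _]; first exact: add_continuous.
  have mulc (S : topologicalType) (a b : S -> R) :
      continuous a -> continuous b -> continuous (fun h => a h * b h).
    by move=> ca cb h; exact: cvgM (ca h) (cb h).
  by apply: mulc; exact: dual_ball_eval_continuous.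
have /cvgrPdist_lt/(_ _ e3) := cw f; apply: filterS => h fh.
have := uw f; have := uw h; move: fh; rewrite !ltr_norml.
by move=> /andP[? ?] /andP[? ?] /andP[? ?]; apply/andP; split; lra.
Qed.

Section diagonal_integral.
Context {R : realType} (X : normedModType R).
Let K := dual_ball X.
Context (mu : probability (borel K) R).

Lemma diagonal_integrable (s : K -> K) (u : itensor X X) :
  measurable_fun [set: borel K]
    ((fun k => itensor_val u (s k, s k)) : borel K -> R) ->
  mu.-integrable [set: borel K]
    (EFin \o ((fun k => itensor_val u (s k, s k)) : borel K -> R)).
Proof.
move=> ms; apply: measurable_bounded_integrable => //.
  by rewrite (le_lt_trans (probability_le1 _ _))// ltry.
exists `|u|; split; first exact: num_real.
move=> M uM k _ /=; apply: le_trans (ltW uM).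
exact: (linf_le_norm (itensor_val u)).
Qed.

(* The identity gives the integral along the diagonal, step maps [s] give
   functionals depending on finitely many points of [K]. *)
Lemma diagonal_functional (s : K -> K) :
  (forall u : itensor X X, measurable_fun [set: borel K]
    ((fun k => itensor_val u (s k, s k)) : borel K -> R)) ->
  exists phi : dual_ball (itensor X X), forall u, dual_ball_fun phi u =
    \int[mu]_(k in [set: borel K]) itensor_val u (s k, s k).
Proof.
move=> ms; have int u := diagonal_integrable (ms u).
have [|||phi phiE phi1] := @dual_of_bounded R (itensor X X)
    (fun u => \int[mu]_(k in [set: borel K]) itensor_val u (s k, s k)) 1.
- move=> a u v; rewrite -[RHS]/(
    a * \int[mu]_(k in [set: borel K]) itensor_val u (s k, s k) +
    \int[mu]_(k in [set: borel K]) itensor_val v (s k, s k)) -RintegralZl// -RintegralD//.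
  exact: (integrableZl _ a (int u)).
- by [].
- move=> u; rewrite mul1r (le_trans (le_normr_Rintegral _ (int u)))//.
  rewrite (_ : `|u| = \int[mu]_(k in [set: borel K]) `|u|); last first.
    by rewrite Rintegral_cst// [X in fine X](probability_setT mu) mulr1.
  apply: le_Rintegral => //.
  + exact: (integrable_norm (int u)).
  + exact: finite_measure_integrable_cst.
  + by move=> k _; exact: (linf_le_norm (itensor_val u)).
- by exists (exist _ phi phi1) => u; rewrite /dual_ball_fun/= phiE.
Qed.

(** Taking the first centre whose neighbourhood contains [k] turns a finite open cover into a
    finitely valued Borel map; [d] is only reached outside the cover. *)
Fixpoint cover_step (N : K -> set K) (d : K) (l : seq K) (k : K) : K :=
  if l is c :: l' then if `[< N c k >] then c else cover_step N d l' k else d.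

Lemma cover_step_measurable N d l (v : K -> R) : (forall c, open (N c)) ->
  measurable_fun [set: borel K] ((v \o cover_step N d l) : borel K -> R).
Proof.
move=> oN; elim: l => [|c l ih]; first exact: (@measurable_cst _ _ (borel K) R setT (v d)).
rewrite (_ : _ \o _ = fun k => if `[< N c k >] then v c else (v \o cover_step N d l) k);
  last by apply/funext => k /=; case: ifP.
apply: measurable_fun_ifT => //; apply: (measurable_fun_bool true).
rewrite setTI (_ : _ @^-1` _ = N c); first exact: sub_gen_smallest.
by apply/seteqP; split => k /= /asboolP.
Qed.

Lemma cover_step_mem N d l k : cover_step N d l k \in d :: l.
Proof.
elim: l => [|c l ih] /=; first by rewrite mem_head.
case: ifP => _; first by rewrite !inE eqxx orbT.
by move: ih; rewrite !inE => /orP[->//|->]; rewrite !orbT.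
Qed.

Lemma cover_stepP N d l k c : c \in l -> N c k -> N (cover_step N d l k) k.
Proof.
elim: l => // b l ih; rewrite inE /=; case: asboolP => // nNb.
by move=> /orP[/eqP-> //|]; exact: ih.
Qed.

(** By compactness finitely many open sets, on each of which every [u] in [us] stays within [e] of
    its value at the centre, cover the ball. Integrating along the step map moves the values by at
    most [e], and the result only sees finitely many functionals, each nonzero at countably many
    [x i]. *)
Lemma diagonal_functional_approx (I : Type) (x : I -> X)
    (phi : dual_ball (itensor X X)) (us : seq (itensor X X)) (e : R) : 0 < e ->
  (forall f : dual X, countable [set i | f (x i) != 0]) ->
  (forall u, dual_ball_fun phi u =
    \int[mu]_(k in [set: borel K]) itensor_val u (k, k)) ->
  exists psi : dual_ball (itensor X X),
    countable [set i | dual_ball_fun psi (etensor (x i) (x i)) != 0] /\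
    forall u, u \in us -> `|dual_ball_fun phi u - dual_ball_fun psi u| <= e.
Proof.
move=> e0 xc phiE.
have [N NP] : {N : K -> set K & forall c, [/\ open (N c), N c c &
    forall u k, u \in us -> N c k ->
      `|itensor_val u (k, k) - itensor_val u (c, c)| <= e]}.
  apply: (@choice _ _ (fun c Nc => [/\ open Nc, Nc c &
    forall u k, u \in us -> Nc k ->
      `|itensor_val u (k, k) - itensor_val u (c, c)| <= e])) => c.
  elim: us => [|v l [V [oV Vc VP]]]; first by exists setT; split => //; exact: openT.
  have /cvgrPdist_lt/(_ _ e0) := @itensor_diag_continuous R X v c.
  rewrite -[X in X -> _]/(nbhs c _) nbhsE => -[W [oW Wc] WP].
  exists (V `&` W); split => //; first exact: openI.
  move=> u k; rewrite inE => /orP[/eqP->|ul] [Vk Wk]; last exact: VP.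
  by rewrite distrC ltW//; exact: WP.
have := @banach_alaoglu R X; rewrite compact_cover => /(_ K setT N)[c _|k _|D _ TD].
- by have [] := NP c.
- by exists k => //; have [] := NP k.
pose s := cover_step N point (finmap.enum_fset D).
have ms (u : itensor X X) : measurable_fun [set: borel K]
    ((fun k => itensor_val u (s k, s k)) : borel K -> R).
  apply: (@cover_step_measurable N point _ (fun k => itensor_val u (k, k))) => c.
  by have [] := NP c.
have mid (u : itensor X X) : measurable_fun [set: borel K]
    ((fun k => itensor_val u (k, k)) : borel K -> R).
  by apply: continuous_borel_measurable; exact: itensor_diag_continuous.
have [psi psiE] := diagonal_functional ms.
exists psi; split.
  apply: (@sub_countable _ _ _ (\bigcup_(c in [set` point :: finmap.enum_fset D])
      [set i | dual_ball_fun c (x i) != 0])); last first.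
    apply: bigcup_countable => [|c _]; last exact: xc.
    exact/finite_set_countable/finite_seq.
  apply: subset_card_le => i /= psi0; apply: contrapT => ni.
  have s0 k : dual_ball_fun (s k) (x i) = 0.
    apply/eqP/negPn/negP => si; apply: ni; exists (s k) => //.
    exact: cover_step_mem.
  move: psi0; rewrite psiE (@eq_Rintegral _ _ _ _ _ (cst 0)).
    by rewrite Rintegral_cst// mul0r eqxx.
  by move=> k _; rewrite /= s0 mul0r.
move=> u uus; rewrite phiE psiE.
have i1 := diagonal_integrable (mid u); have i2 := diagonal_integrable (ms u).
have i12 := integrableB measurableT i1 i2.
rewrite -RintegralB// (le_trans (le_normr_Rintegral _ i12))//.
rewrite (_ : e = \int[mu]_(k in [set: borel K]) e); last first.
  by rewrite Rintegral_cst// [X in fine X](probability_setT mu) mulr1.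
apply: le_Rintegral => //.
- exact: (integrable_norm i12).
- exact: finite_measure_integrable_cst.
- move=> k _; have [c cD Nc] := TD k Logic.I.
  have [_ _ NsP] := NP (s k); apply: NsP => //.
  exact: cover_stepP cD Nc.
Qed.

End diagonal_integral.

(** The open set where [|h|] exceeds half of [|h k|] contains [k], hence has positive measure, and
    the integrand is bounded below there by a positive constant. *)
Lemma integral_sqr_gt0 {R : realType} (K : ptopologicalType)
    (mu : probability (borel K) R) (h : K -> R) (k : K) :
  continuous h -> (exists M, forall k, `|h k| <= M) ->
  measure_support mu k -> h k != 0 ->
  0 < \int[mu]_(k in [set: borel K]) (h k * h k).
Proof.
move=> ch [M hM] Sk hk.
pose c := `|h k| / 2; have c0 : 0 < c by rewrite divr_gt0 ?normr_gt0.
have cnorm : continuous (fun k => `|h k|).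
  move=> j; apply: (@continuous_comp _ _ _ h (fun r : R => `|r|)); first exact: ch.
  exact: (@norm_continuous R R^o).
pose U : set (borel K) := [set j | c < `|h j|].
have oU : open (U : set K).
  by apply: (@open_comp _ _ (fun k => `|h k|) [set r | c < r]);
    [move=> j _; exact: cnorm|exact: open_gt].
have mU : measurable U by exact: sub_gen_smallest.
have muU : (0 < mu U)%E.
  apply: Sk => //; rewrite /U/= /c ltr_pdivrMr// ltr_pMr ?normr_gt0//.
  by rewrite ltr1n.
have mh : measurable_fun [set: borel K] ((fun k => h k * h k) : borel K -> R).
  by apply: measurable_funM; exact: continuous_borel_measurable.
have ih : mu.-integrable [set: borel K] (EFin \o ((fun k => h k * h k) : borel K -> R)).
  apply: measurable_bounded_integrable => //.
    by rewrite (le_lt_trans (probability_le1 _ _))// ltry.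
  exists (M * M); split; first exact: num_real.
  move=> r Mr j _ /=; apply: le_trans (ltW Mr).
  by rewrite normrM ler_pM.
rewrite -lte_fin /Rintegral fineK; last exact: integrable_fin_num.
apply: (@lt_le_trans _ _ ((c * c)%:E * mu U)%E).
  by rewrite mule_gt0// lte_fin mulr_gt0.
rewrite -integral_cst//.
apply: (@le_trans _ _ (\int[mu]_(j in U) (h j * h j)%:E)%E).
  apply: ge0_le_integral => //.
  - by move=> j _; rewrite lee_fin mulr_ge0// ltW.
  - by apply/measurable_EFinP; exact: measurable_funS mh.
  - move=> j Uj; rewrite lee_fin -[leRHS]ger0_norm; last by rewrite -expr2 sqr_ge0.
    by rewrite normrM ler_pM// ltW.
apply: ge0_subset_integral => //; first exact/measurable_EFinP.
by move=> j _; rewrite lee_fin -expr2 sqr_ge0.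
Qed.

(** * Property (M) from the tensor square, and the equivalence *)

Lemma property_M_of_wld_itensor {R : realType} (X : normedModType R) :
  wld X -> wld (itensor X X) -> property_M R (dual_ball X).
Proof.
move=> /wldP[I [x [_ xc xtot]]] /wldP[J [z [_ zc ztot]]] mu _.
apply: (dual_ball_separable xtot).
have mid (u : itensor X X) : measurable_fun [set: borel (dual_ball X)]
    ((fun k => itensor_val u (k, k)) : borel (dual_ball X) -> R).
  by apply: continuous_borel_measurable; exact: itensor_diag_continuous.
have [phi phiE] := diagonal_functional mu mid.
apply: (@sub_countable _ _ _ [set i | dual_ball_fun phi (etensor (x i) (x i)) != 0]).
  apply: subset_card_le => i /= [k Sk kx]; rewrite phiE gt_eqF//.
  apply: (@integral_sqr_gt0 R _ mu (fun f => dual_ball_fun f (x i)) k) => //.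
  - exact: dual_ball_eval_continuous.
  - by exists `|x i| => f; exact: dual_ball_le.
(* Two families are at work: [z], given by the tensor square being WLD, drives the convergence,
   while supports are counted on the diagonal tensors of the [x i]. *)
apply: (countable_support_approx zc ztot) => us e e0.
exact: (diagonal_functional_approx us e0 xc phiE).
Qed.

Theorem corollary7p6 (R : realType) (X : completeNormedModType R) :
  (wld X /\ property_M R (dual_ball X)) <-> wld (itensor X X).
Proof.
split=> [[Xwld XM]|XXwld]; first exact: wld_itensor.
have Xwld : wld X.
  have [[e e0]|X0] := pselect (exists e : X, e != 0); first exact: wld_of_itensor e0 _.
  by apply: wld_trivial => x; apply/eqP/negPn/negP => x0; apply: X0; exists x.
by split=> //; exact: property_M_of_wld_itensor.
Qed.
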